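(* Let $m\ge2$, $1\le n\le m$, let $\rho_{AB_1\cdots B_n}$ be a state, and let $\mathbf{M}=\{M_1,\dots,M_m\}$ be measurements on $A$ given by orthonormal bases. Let $\mathbf{S}_1,\dots,\mathbf{S}_n$ be nonempty, pairwise disjoint subsets of $\mathbf{M}$ with $\bigcup_t\mathbf{S}_t=\mathbf{M}$, and $m_t=|\mathbf{S}_t|$. Then $$\sum_{t=1}^n\sum_{M_i\in\mathbf{S}_t}S(M_i|B_t)\ \ge\ \frac{1}{m-1}\sum_{i<j}Q^{M_{i,j}}+\frac{1}{m-1}\sum_{t=1}^n\frac{m_t(m_t-1)}{2}S(A|B_t)+\max\{0,\delta_{mn}\},$$ where $$\delta_{mn}=\frac{m(m-1)-\sum_{t=1}^n m_t(m_t-1)}{2(m-1)}S(A)+\sum_{t=1}^n\frac{m_t(m_t-1)}{2(m-1)}\mathcal{I}(A:B_t)-\sum_{t=1}^n\sum_{M_i\in\mathbf{S}_t}\mathcal{I}(M_i:B_t).$$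
   Context: All logarithms are base 2; all Hilbert spaces are finite-dimensional, $\dim\mathcal{H}_A=d$. For a state $\sigma$, $S(\sigma)=-\mathrm{tr}\,\sigma\log_2\sigma$; $S(A)=S(\rho_A)$, $S(A|B_t)=S(\rho_{AB_t})-S(\rho_{B_t})$, and $\mathcal{I}(A:B_t)=S(\rho_A)+S(\rho_{B_t})-S(\rho_{AB_t})$, where reduced states are partial traces of $\rho_{AB_1\cdots B_n}$. For a measurement $M$ on $A$ given by an orthonormal basis $\{|\varphi_j\rangle\}$ and a subsystem $X$, $\rho_{MX}=\sum_j(|\varphi_j\rangle\langle\varphi_j|\otimes I_X)\rho_{AX}(|\varphi_j\rangle\langle\varphi_j|\otimes I_X)$, $S(M|X)=S(\rho_{MX})-S(\rho_X)$, $H(M)=-\sum_j p_j\log_2p_j$ with $p_j=\langle\varphi_j|\rho_A|\varphi_j\rangle$, and $\mathcal{I}(M:X)=H(M)+S(\rho_X)-S(\rho_{MX})$ (Holevo quantity). For two measurements $M_i,M_j$ with bases $\{|\varphi^i_k\rangle\}$, $\{|\varphi^j_l\rangle\}$, let $c^{i,j}_{kl}=|\langle\varphi^i_k|\varphi^j_l\rangle|^2$, $c^{i,j}_{\max}=\max_{k,l}c^{i,j}_{kl}$, $c^{i,j}_2$ the second largest element of the matrix $[c^{i,j}_{kl}]$, and $q^{M_{i,j}}_{MU}=-\log_2 c^{i,j}_{\max}$. Define: (i) $\widetilde q^{M_{i,j}}=q^{M_{i,j}}_{MU}+\tfrac12(1-\sqrt{c^{i,j}_{\max}})\log_2\frac{c^{i,j}_{\max}}{c^{i,j}_2}$;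 (ii) $q^{M_{i,j}}(\rho_A)=\max\{\sum_k p^{i}_k\log_2(1/\max_l c^{i,j}_{kl}),\ \sum_l p^{j}_l\log_2(1/\max_k c^{i,j}_{kl})\}$ with $p^i_k=\langle\varphi^i_k|\rho_A|\varphi^i_k\rangle$, $p^j_l=\langle\varphi^j_l|\rho_A|\varphi^j_l\rangle$; (iii) $q^{M_{i,j}}=\max_{0\le p\le1}\lambda_{\min}[p\Delta_{M_iM_j}+(1-p)\Delta_{M_jM_i}]$, where $\lambda_{\min}$ is the smallest eigenvalue, $\Delta_{M_iM_j}=\sum_k\log_2(1/\max_l c^{i,j}_{kl})|\varphi^i_k\rangle\langle\varphi^i_k|$ and $\Delta_{M_jM_i}=\sum_l\log_2(1/\max_k c^{i,j}_{kl})|\varphi^j_l\rangle\langle\varphi^j_l|$. $Q^{M_{i,j}}$ denotes any one of these three quantities (for each pair $i<j$). *)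

(* Defs.v *)
From HB Require Import structures.
From mathcomp Require Import all_boot all_order all_algebra.
From mathcomp Require Import complex.
From mathcomp Require Import classical_sets reals exp.

Set Implicit Arguments.
Unset Strict Implicit.
Unset Printing Implicit Defensive.
Import Order.TTheory GRing.Theory Num.Theory.

Local Open Scope ring_scope.

Section QuantumDefs.
Variable R : realType.
Local Notation C := (R[i]).

Definition log2 (x : R) : R := ln x / ln 2.

(** -x log2 x  (equal to 0 at x = 0) *)
Definition etaf (x : R) : R := - (x * log2 x).

(** Operators on a finite-dimensional Hilbert space C^T (T a finite index
    set, the orthonormal computational basis) are given by their matrix
    entries  rho x y = <x|rho|y>. *)
Definition mx_of (T : finType) (rho : T -> T -> C) : 'M[C]_#|T| :=
  \matrix_(i, j) rho (enum_val i) (enum_val j).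

(** the eigenvalues (with multiplicity) of a square complex matrix:
    the roots of its characteristic polynomial *)
Definition eigs (k : nat) (A : 'M[C]_k) : seq C :=
  sval (closed_field_poly_normal (char_poly A)).

(** von Neumann entropy  S(sigma) = - tr sigma log2 sigma
    = - sum_lambda lambda log2 lambda over the eigenvalues of sigma *)
Definition vN (T : finType) (sigma : T -> T -> C) : R :=
  \sum_(z <- eigs (mx_of sigma)) etaf (complex.Re z).

Definition lambda_min (k : nat) (A : 'M[C]_k) : R :=
  let s := [seq complex.Re z | z <- eigs A] in \big[Num.min/head 0 s]_(x <- s) x.

Definition is_state (T : finType) (rho : T -> T -> C) : Prop :=
  [/\ (forall x y, rho y x = conjc (rho x y)),
      (forall v : T -> C, 0 <= \sum_x \sum_y conjc (v x) * rho x y * v y)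
    & \sum_x rho x x = 1].

(** Index set of A B_1 ... B_n: dim A = d, dim B_t = e t. *)
Definition Bidx (n : nat) (e : 'I_n -> nat) := {dffun forall t : 'I_n, 'I_(e t)}.
Definition Jidx (d n : nat) (e : 'I_n -> nat) := ('I_d * Bidx e)%type.

Section Partial.
Variables (d n : nat) (e : 'I_n -> nat).
Variable rho : Jidx d e -> Jidx d e -> C.

Definition rhoA : 'I_d -> 'I_d -> C := fun a a' =>
  \sum_(x : Jidx d e) \sum_(x' : Jidx d e)
     (if [&& x.1 == a, x'.1 == a' & x.2 == x'.2] then rho x x' else 0).

Definition rhoB (t : 'I_n) : 'I_(e t) -> 'I_(e t) -> C := fun b b' =>
  \sum_(x : Jidx d e) \sum_(x' : Jidx d e)
     (if [&& x.2 t == b, x'.2 t == b', x.1 == x'.1 &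
            [forall s, (s != t) ==> (x.2 s == x'.2 s)]]
      then rho x x' else 0).

Definition rhoAB (t : 'I_n) : ('I_d * 'I_(e t))%type -> ('I_d * 'I_(e t))%type -> C :=
  fun ab ab' =>
  \sum_(x : Jidx d e) \sum_(x' : Jidx d e)
     (if [&& x.1 == ab.1, x'.1 == ab'.1, x.2 t == ab.2, x'.2 t == ab'.2 &
            [forall s, (s != t) ==> (x.2 s == x'.2 s)]]
      then rho x x' else 0).
End Partial.

(** A measurement on A given by an orthonormal basis {|phi_k>}: the basis
    vectors are the columns of U, phi_k(a) = U a k. *)
Definition ortho_basis (d : nat) (U : 'M[C]_d) : Prop :=
  forall k l : 'I_d, \sum_(a < d) conjc (U a k) * U a l = (k == l)%:R.

Definition condEnt (T K : finType) (rhoAX : (T * K)%type -> (T * K)%type -> C)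
  (rhoX : K -> K -> C) : R := vN rhoAX - vN rhoX.

Definition mutInf (T K : finType) (rhoA' : T -> T -> C) (rhoX : K -> K -> C)
  (rhoAX : (T * K)%type -> (T * K)%type -> C) : R :=
  vN rhoA' + vN rhoX - vN rhoAX.

Section Measure.
Variables (d : nat) (U : 'M[C]_d).

(** rho_{MX} = sum_j (|phi_j><phi_j| (x) I_X) rho_{AX} (|phi_j><phi_j| (x) I_X) *)
Definition rhoMX (K : finType) (sigma : ('I_d * K)%type -> ('I_d * K)%type -> C) :
    ('I_d * K)%type -> ('I_d * K)%type -> C := fun x y =>
  \sum_(j < d) \sum_(a < d) \sum_(a' < d)
     (U x.1 j * conjc (U a j)) * sigma (a, x.2) (a', y.2) * (U a' j * conjc (U y.1 j)).

Definition prob (rA : 'I_d -> 'I_d -> C) (j : 'I_d) : R :=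
  complex.Re (\sum_(a < d) \sum_(a' < d) conjc (U a j) * rA a a' * U a' j).

Definition shannonM (rA : 'I_d -> 'I_d -> C) : R := \sum_(j < d) etaf (prob rA j).

Definition condEntM (K : finType) (sigma : ('I_d * K)%type -> ('I_d * K)%type -> C)
  (rhoX : K -> K -> C) : R := vN (rhoMX sigma) - vN rhoX.

Definition holevo (rA : 'I_d -> 'I_d -> C) (K : finType)
  (sigma : ('I_d * K)%type -> ('I_d * K)%type -> C) (rhoX : K -> K -> C) : R :=
  shannonM rA + vN rhoX - vN (rhoMX sigma).
End Measure.

Section Overlap.
Variables (d : nat) (U V : 'M[C]_d).

Definition sqnorm (z : C) : R := complex.Re z ^+ 2 + complex.Im z ^+ 2.

Definition cc (k l : 'I_d) : R := sqnorm (\sum_(a < d) conjc (U a k) * V a l).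

Definition cmax : R := \big[Num.max/0]_(kl : 'I_d * 'I_d) cc kl.1 kl.2.

Definition c2 : R :=
  nth 0 (sort (fun x y : R => y <= x) [seq cc kl.1 kl.2 | kl : ('I_d * 'I_d)%type]) 1.

Definition qMU : R := - log2 cmax.

Definition q_tilde : R := qMU + 2^-1 * (1 - Num.sqrt cmax) * log2 (cmax / c2).

Definition rowmax (k : 'I_d) : R := \big[Num.max/0]_(l < d) cc k l.
Definition colmax (l : 'I_d) : R := \big[Num.max/0]_(k < d) cc k l.

Definition q_state (rA : 'I_d -> 'I_d -> C) : R :=
  Num.max (\sum_(k < d) prob U rA k * log2 (1 / rowmax k))
          (\sum_(l < d) prob V rA l * log2 (1 / colmax l)).

Definition DeltaUV : 'M[C]_d :=
  \matrix_(a, b) \sum_(k < d) (log2 (1 / rowmax k))%:C%C * U a k * conjc (U b k).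
Definition DeltaVU : 'M[C]_d :=
  \matrix_(a, b) \sum_(l < d) (log2 (1 / colmax l))%:C%C * V a l * conjc (V b l).

(** (iii) : max over p in [0,1] (the maximum exists; written as sup) *)
Definition q_opt : R :=
  sup [set x : R | exists p : R, 0 <= p <= 1 /\
        x = lambda_min ((p%:C)%C *: DeltaUV + ((1 - p)%:C)%C *: DeltaVU)]%classic.
End Overlap.

Inductive Qkind := Qtilde | Qstate | Qopt.

Definition Qval (k : Qkind) (d : nat) (U V : 'M[C]_d) (rA : 'I_d -> 'I_d -> C) : R :=
  match k with
  | Qtilde => q_tilde U V
  | Qstate => q_state U V rA
  | Qopt => q_opt U V
  end.

End QuantumDefs.

Arguments rhoB [R d n e] rho t _ _.
Arguments rhoAB [R d n e] rho t _ _.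

(* Main.v *)
(* Summing over the pairs i < j, the theorem follows from three relations for two
   measurements X, Z: with the same memory, S(X|B) + S(Z|B) >= Q + S(A|B); with distinct
   memories, S(X|B) + S(Z|C) >= Q; without memory, H(X) + H(Z) >= Q + S(A), which gives the
   term in delta.  All three quantities Q are at most the state-dependent one, and all three
   relations follow from a single one, for a state on A B F:
     S(ZBF) - S(ABF) >= S(B) - S(XB) + sum_j p_j log(1 / max_k c_jk).
   For distinct memories, purify by C: then S(ZBF) = S(ZC) and S(ABF) = S(C).
   The left side is the relative entropy of rho_ABF and its Z-pinching; trace out F and pinch
   in the basis X: data processing bounds it below by the relative entropy of rho_XB and
   sum_j (max_k c_jk) |x_j><x_j| (x) rho_B, which dominates the pinched second argument.
   Monotonicity comes from ln x = int_0^1 (x - 1) / (1 + s (x - 1)) ds, which writes the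
   relative entropy as a limit of sums of quantities
     sup_Y 2 Re tr(rho Y^* ) - (1 - s) tr(rho Y Y^* ) - s tr(sigma Y^* Y);
   each is a supremum of functions linear in (rho, sigma), and a test operator Y for the
   reduced system lifts to the large one. *)
Require Import Defs.
From HB Require Import structures.
From mathcomp Require Import all_boot all_order all_algebra.
From mathcomp Require Import complex sesquilinear spectral.
From mathcomp Require Import reals exp.
From mathcomp Require Import ring lra.
Import Order.TTheory GRing.Theory Num.Theory.
Set Implicit Arguments.
Unset Strict Implicit.
Unset Printing Implicit Defensive.
Local Open Scope ring_scope.
Local Open Scope sesquilinear_scope.

(** * Entropies from spectral decompositions *)

(* Both sides are the determinant of [[X, A], [B, 1]], up to powers of X. *)
Lemma char_poly_mulmxC (F : comNzRingType) (m n : nat) (A : 'M[F]_(m, n)) (B : 'M[F]_(n, m)) :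
  char_poly (A *m B) * 'X^n = 'X^m * char_poly (B *m A).
Proof.
pose A' := map_mx polyC A; pose B' := map_mx polyC B.
pose M := block_mx 'X%:M A' B' 1%:M.
have e1 : M *m block_mx 1%:M 0 (- B') 1%:M = block_mx ('X%:M - A' *m B') A' 0 1%:M.
  rewrite mulmx_block !mulmx1 !mul1mx !mulmx0 !mulmxN !add0r subrr.
  by [].
have e2 : M *m block_mx 1%:M (- A') 0 'X%:M = block_mx 'X%:M 0 B' ('X%:M - B' *m A').
  rewrite mulmx_block !mulmx1 !mul1mx !mulmx0 !mulmxN !addr0.
  rewrite mul_scalar_mx mul_mx_scalar addNr.
  by rewrite [X in block_mx _ _ _ X]addrC.
have := congr1 determinant e1; rewrite det_mulmx det_lblock det_ublock !det1 !mulr1.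
have := congr1 determinant e2; rewrite det_mulmx det_lblock det_ublock !det1 !mul1r.
rewrite !det_scalar => d2 d1.
by rewrite /char_poly /char_poly_mx !map_mxM -/A' -/B' -d1 -d2.
Qed.

Section Eigenvalues.
Variable R : realType.
Local Notation C := (R[i]).

Lemma char_poly_eigs k (A : 'M[C]_k) : char_poly A = \prod_(z <- eigs A) ('X - z%:P).
Proof.
rewrite /eigs; case: closed_field_poly_normal => s /= {1}->.
by rewrite (monicP (char_poly_monic A)) scale1r.
Qed.

Lemma eigs_char_poly k (A : 'M[C]_k) s :
  char_poly A = \prod_(z <- s) ('X - z%:P) -> perm_eq (eigs A) s.
Proof. by rewrite char_poly_eigs => /prod_XsubC_eq. Qed.

Lemma prod_XsubC_nseq0 (n : nat) : \prod_(z <- nseq n (0 : C)) ('X - z%:P) = 'X^n.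
Proof. by rewrite big_nseq subr0; elim: n => [|n IH]; rewrite ?expr0 //= IH exprS. Qed.

(** By [char_poly_mulmxC] the two products have the same eigenvalues up to copies of 0, which
    [h 0 = 0] makes invisible. *)
Lemma sum_eigs_mulmxC (h : C -> R) m n (A : 'M[C]_(m, n)) (B : 'M[C]_(n, m)) :
  h 0 = 0 -> \sum_(z <- eigs (A *m B)) h z = \sum_(z <- eigs (B *m A)) h z.
Proof.
move=> h0; have := char_poly_mulmxC A B.
rewrite !char_poly_eigs -!prod_XsubC_nseq0 -!big_cat => /prod_XsubC_eq e.
have := perm_big (op := +%R) (x := 0) _ e (P := xpredT) (F := h).
rewrite !big_cat !big_nseq /= h0.
by rewrite !iter_addr_0 !mul0rn addr0 add0r.
Qed.

Lemma eigs_tr k (A : 'M[C]_k) : perm_eq (eigs A^T) (eigs A).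
Proof.
apply: eigs_char_poly; rewrite -char_poly_eigs /char_poly -det_tr.
by rewrite /char_poly_mx -map_trmx linearB /= trmxK tr_scalar_mx.
Qed.

Lemma eigs_diag k (l : 'I_k -> C) :
  perm_eq (eigs (diag_mx (\row_i l i))) [seq l i | i <- enum 'I_k].
Proof.
apply: eigs_char_poly; rewrite char_poly_trig ?diag_mx_is_trig // big_map big_enum /=.
by apply: eq_bigr => i _; rewrite !mxE eqxx.
Qed.

End Eigenvalues.

(** * Hermitian and positive kernels: diagonalization, Gram form, entropy *)

Section Operators.
Variable R : realType.
Local Notation C := (R[i]).
Local Notation "x %:C" := (real_complex R x).

Lemma conjC_conjc (z : C) : Num.conj z = conjc z.
Proof. by []. Qed.

Lemma conjcM (x y : C) : conjc (x * y) = conjc x * conjc y.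
Proof. exact: rmorphM. Qed.

Lemma conjcD (x y : C) : conjc (x + y) = conjc x + conjc y.
Proof. exact: rmorphD. Qed.

Lemma conjcB (x y : C) : conjc (x - y) = conjc x - conjc y.
Proof. exact: rmorphB. Qed.

Lemma conjc_sum (I : finType) (P : pred I) (F : I -> C) :
  conjc (\sum_(i | P i) F i) = \sum_(i | P i) conjc (F i).
Proof. exact: rmorph_sum. Qed.

Definition ortho_family (T I : finType) (V : I -> T -> C) :=
  forall i j, \sum_x conjc (V i x) * V j x = (i == j)%:R.

Definition complete (T I : finType) (V : I -> T -> C) :=
  forall x y, \sum_i V i x * conjc (V i y) = (x == y)%:R.

(** This is the reduced state on T of the (unnormalized) vector psi in T (x) G. States are handled
    in this form, so that a purification is at hand and a partial trace is a regrouping of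
    indices. *)
Definition gram (T G : finType) (psi : T -> G -> C) : T -> T -> C :=
  fun x y => \sum_g psi x g * conjc (psi y g).

Lemma eq_vN (T : finType) (s1 s2 : T -> T -> C) : s1 =2 s2 -> vN s1 = vN s2.
Proof.
move=> e; rewrite /vN; congr (\sum_(z <- eigs _) _).
by apply/matrixP => i j; rewrite !mxE.
Qed.

Lemma etaf0 : etaf 0 = 0 :> R.
Proof. by rewrite /etaf mul0r oppr0. Qed.

Lemma sum_enum_val (T : finType) (M : nmodType) (F : T -> M) :
  \sum_(i < #|T|) F (enum_val i) = \sum_x F x.
Proof. by rewrite -(big_enum_val (A := T)). Qed.

(** The kernel is a product [A *m B] whose reverse [B *m A] is the diagonal matrix of the l i. The
    family V may be incomplete: eigenvalues missing from l are 0 and contribute [etaf 0 = 0]. *)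
Lemma vN_decomposition (T I : finType) (V : I -> T -> C) (l : I -> R) :
  ortho_family V ->
  vN (fun x y => \sum_i (l i)%:C * (V i x * conjc (V i y))) = \sum_i etaf (l i).
Proof.
move=> oV; rewrite /vN.
pose A : 'M[C]_(#|T|, #|I|) := \matrix_(x, i) V (enum_val i) (enum_val x).
pose B : 'M[C]_(#|I|, #|T|) :=
  \matrix_(i, x) ((l (enum_val i))%:C * conjc (V (enum_val i) (enum_val x))).
have -> : mx_of (fun x y => \sum_i (l i)%:C * (V i x * conjc (V i y))) = A *m B.
  apply/matrixP => x y; rewrite !mxE /gram -sum_enum_val; apply: eq_bigr => i _.
  by rewrite !mxE; ring.
rewrite (sum_eigs_mulmxC (h := fun z => etaf (complex.Re z))) ?etaf0 //.
have -> : B *m A = diag_mx (\row_i (l (enum_val i))%:C).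
  apply/matrixP => i j; rewrite !mxE.
  under eq_bigr do rewrite !mxE -mulrA.
  rewrite -mulr_sumr (sum_enum_val (fun x => conjc (V (enum_val i) x) * V (enum_val j) x)).
  by rewrite oV (inj_eq enum_val_inj) mulr_natr.
rewrite (perm_big _ (eigs_diag _)) big_map big_enum /=.
by rewrite (sum_enum_val (fun i => etaf (l i))).
Qed.

(** The two marginals of a pure vector have the same nonzero spectrum: they are [A *m B] and the
    transpose of [B *m A]. *)
Lemma vN_gram_swap (T G : finType) (psi : T -> G -> C) :
  vN (gram psi) = vN (gram (fun g x => psi x g)).
Proof.
rewrite /vN.
pose A : 'M[C]_(#|T|, #|G|) := \matrix_(x, g) psi (enum_val x) (enum_val g).
pose B : 'M[C]_(#|G|, #|T|) := \matrix_(g, x) conjc (psi (enum_val x) (enum_val g)).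
have -> : mx_of (gram psi) = A *m B.
  by apply/matrixP => x y; rewrite !mxE /gram -sum_enum_val; apply: eq_bigr => i _; rewrite !mxE.
have -> : mx_of (gram (fun g x => psi x g)) = (B *m A)^T.
  apply/matrixP => x y; rewrite !mxE /gram -sum_enum_val; apply: eq_bigr => i _.
  by rewrite !mxE mulrC.
rewrite [RHS](perm_big _ (eigs_tr (B *m A))) /=.
exact: (sum_eigs_mulmxC (h := fun z => etaf (complex.Re z)) A B etaf0).
Qed.

Lemma hermitian_mx_diagonalization k (A : 'M[C]_k) :
  (forall i j, A j i = conjc (A i j)) ->
  exists l : 'I_k -> R, exists V : 'I_k -> 'I_k -> C,
    [/\ ortho_family V, complete V,
        forall x y, A x y = \sum_i (l i)%:C * (V i x * conjc (V i y))
      & perm_eq (eigs A) [seq (l i)%:C | i <- enum 'I_k]].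
Proof.
move=> hA.
have Ah : A \is hermsymmx.
  apply/is_hermitianmxP; rewrite expr0 scale1r; apply/matrixP => i j.
  by rewrite !mxE hA.
have /hermitian_spectral_diag_real /mxOverP real_l := Ah.
have /hermitian_normalmx /orthomx_spectralP := Ah.
rewrite invmx_unitary ?spectral_unitarymx //.
set P := spectralmx A; set D := spectral_diag A => defA.
have uP : P \is unitarymx by exact: spectral_unitarymx.
pose l i := complex.Re (D 0 i).
have lE i : (l i)%:C = D 0 i by apply: RRe_real; exact: real_l.
have rowP : P *m P^t* = 1%:M by apply/unitarymxP.
have colP : P^t* *m P = 1%:M by rewrite -invmx_unitary // mulVmx // unitarymx_unit.
(* The spectral theorem gives A = P^* D P with P unitary, so the eigenvectors are the conjugated
   rows of P. *)
exists l, (fun i x => conjc (P i x)); split.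
- move=> i j; have /matrixP /(_ i j) := rowP; rewrite !mxE => <-.
  by apply: eq_bigr => x _; rewrite !mxE conjcK.
- move=> x y; have /matrixP /(_ x y) := colP; rewrite !mxE => <-.
  by apply: eq_bigr => i _; rewrite !mxE conjcK.
- move=> x y; rewrite {1}defA !mxE; apply: eq_bigr => i _.
  rewrite !mxE conjcK lE (bigD1 i) //= big1 ?addr0; last first.
    by move=> j ji; rewrite !mxE (negPf ji) mulr0.
  by rewrite !mxE eqxx conjC_conjc mulr1n; ring.
- apply: eigs_char_poly; rewrite big_map big_enum /=.
  (* Cyclicity moves the factor [P^t*] to the right end, where it cancels P; the common power of X
     is then removed. *)
  have -> : char_poly A = char_poly (diag_mx D *m P *m P^t*).
    apply: (@mulfI _ ('X^k)); first by rewrite monic_neq0 ?monicXn.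
    by have := char_poly_mulmxC (P^t* ) (diag_mx D *m P); rewrite mulmxA -defA mulrC.
  rewrite -mulmxA rowP mulmx1 char_poly_trig ?diag_mx_is_trig //.
  by apply: eq_bigr => i _; rewrite !mxE eqxx lE.
Qed.

Definition ip (T : finType) (f g : T -> C) := \sum_x conjc (f x) * g x.

Definition qf (T : finType) (s : T -> T -> C) (f g : T -> C) :=
  \sum_x \sum_y conjc (f x) * s x y * g y.

Definition diagonalizes (T I : finType) (s : T -> T -> C) (l : I -> R) (V : I -> T -> C) :=
  forall x y, s x y = \sum_i (l i)%:C * (V i x * conjc (V i y)).

Lemma conj_ip (T : finType) (f g : T -> C) : conjc (ip f g) = ip g f.
Proof.
rewrite /ip rmorph_sum; apply: eq_bigr => x _.
by rewrite rmorphM /= conjcK mulrC.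
Qed.

Lemma parseval (T I : finType) (V : I -> T -> C) (f g : T -> C) :
  complete V -> \sum_i ip f (V i) * ip (V i) g = ip f g.
Proof.
move=> cV; rewrite /ip.
under eq_bigr do rewrite big_distrlr /=.
rewrite exchange_big; apply: eq_bigr => x _ /=.
rewrite exchange_big /= (bigD1 x) //= [X in _ + X]big1 ?addr0; last first.
  move=> y yx; transitivity (conjc (f x) * g y * \sum_i V i x * conjc (V i y)).
    by rewrite mulr_sumr; apply: eq_bigr => i _; ring.
  by rewrite cV eq_sym (negPf yx) mulr0.
transitivity (conjc (f x) * g x * \sum_i V i x * conjc (V i x)).
  by rewrite mulr_sumr; apply: eq_bigr => i _; ring.
by rewrite cV eqxx mulr1.
Qed.

Lemma qf_diagonal (T I : finType) (s : T -> T -> C) (l : I -> R) (V : I -> T -> C) f g :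
  diagonalizes s l V -> qf s f g = \sum_i (l i)%:C * (ip f (V i) * ip (V i) g).
Proof.
move=> ds; rewrite /qf /ip.
under [RHS]eq_bigr do rewrite big_distrlr mulr_sumr /=.
rewrite [RHS]exchange_big; apply: eq_bigr => x _ /=.
under [RHS]eq_bigr do rewrite mulr_sumr /=.
rewrite [RHS]exchange_big; apply: eq_bigr => y _ /=.
by rewrite ds mulr_sumr mulr_suml; apply: eq_bigr => i _; ring.
Qed.

Lemma qf_gram (T G : finType) (psi : T -> G -> C) f g :
  qf (gram psi) f g = \sum_c ip f (psi^~ c) * ip (psi^~ c) g.
Proof.
rewrite /qf /ip /gram.
under [RHS]eq_bigr do rewrite big_distrlr /=.
rewrite [RHS]exchange_big; apply: eq_bigr => x _ /=.
rewrite [RHS]exchange_big; apply: eq_bigr => y _ /=.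
by rewrite mulr_sumr mulr_suml; apply: eq_bigr => i _; ring.
Qed.

Lemma eq_qf (T : finType) (s1 s2 : T -> T -> C) f g : s1 =2 s2 -> qf s1 f g = qf s2 f g.
Proof. by move=> e; apply: eq_bigr => x _; apply: eq_bigr => y _; rewrite e. Qed.

Lemma qf_eigen (T I : finType) (s : T -> T -> C) (l : I -> R) (V : I -> T -> C) i j :
  ortho_family V -> diagonalizes s l V -> qf s (V i) (V j) = (l i)%:C * (i == j)%:R.
Proof.
move=> oV ds; rewrite (qf_diagonal _ _ ds) (bigD1 i) //= big1 ?addr0 => [|k ki].
  by rewrite [ip _ (V i)]oV [ip _ _]oV eqxx mul1r.
by rewrite [ip _ (V k)]oV eq_sym (negPf ki) mul0r mulr0.
Qed.

Lemma qf_gram_ge0 (T G : finType) (psi : T -> G -> C) f : 0 <= qf (gram psi) f f.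
Proof.
rewrite qf_gram; apply: sumr_ge0 => c _.
by rewrite -(conj_ip (psi^~ c)) mulrC mulcJ_ge0.
Qed.

Lemma conj_gram (T G : finType) (psi : T -> G -> C) x y :
  gram psi y x = conjc (gram psi x y).
Proof.
rewrite /gram rmorph_sum; apply: eq_bigr => c _.
by rewrite rmorphM /= conjcK mulrC.
Qed.

Lemma psd_diagonalization (T : finType) (s : T -> T -> C) :
  (forall x y, s y x = conjc (s x y)) -> (forall f, 0 <= qf s f f) ->
  exists l : T -> R, exists V : T -> T -> C,
    [/\ forall i, 0 <= l i, ortho_family V, complete V & diagonalizes s l V].
Proof.
move=> hs ps.
have [|l [V [oV cV dV _]]] := @hermitian_mx_diagonalization #|T| (mx_of s).
  by move=> i j; rewrite !mxE.
pose W i x := V (enum_rank i) (enum_rank x).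
have oW : ortho_family W.
  move=> i j; rewrite -(inj_eq enum_rank_inj) -oV -[LHS]sum_enum_val.
  by apply: eq_bigr => x _; rewrite /W enum_valK.
have cW : complete W.
  move=> x y; rewrite -(inj_eq enum_rank_inj) -cV -[LHS]sum_enum_val.
  by apply: eq_bigr => i _; rewrite /W enum_valK.
have dW : diagonalizes s (l \o enum_rank) W.
  move=> x y; have := dV (enum_rank x) (enum_rank y).
  rewrite !mxE !enum_rankK => ->; rewrite -[RHS]sum_enum_val.
  by apply: eq_bigr => i _; rewrite /W /= enum_valK.
exists (l \o enum_rank), W; split=> // i.
by have := ps (W i); rewrite (qf_eigen _ _ oW dW) eqxx mulr1 ler0c.
Qed.

Lemma gram_diagonalization (T G : finType) (psi : T -> G -> C) :
  exists l : T -> R, exists V : T -> T -> C,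
    [/\ forall i, 0 <= l i, ortho_family V, complete V, diagonalizes (gram psi) l V
      & vN (gram psi) = \sum_i etaf (l i)].
Proof.
have [||l [V [l0 oV cV dV]]] := @psd_diagonalization T (gram psi).
- exact: conj_gram.
- exact: qf_gram_ge0.
exists l, V; split=> //.
by rewrite -(vN_decomposition l oV); apply: eq_vN.
Qed.

(** The vectors sqrt(l i) V i of a spectral decomposition serve as the columns of psi: this is a
    purification by a copy of T. *)
Lemma psd_gram (T : finType) (s : T -> T -> C) :
  (forall x y, s y x = conjc (s x y)) -> (forall f, 0 <= qf s f f) ->
  exists psi : T -> T -> C, s =2 gram psi.
Proof.
move=> hs ps; have [l [V [l0 oV cV dV]]] := psd_diagonalization hs ps.
exists (fun x i => (Num.sqrt (l i))%:C * V i x) => x y; rewrite dV.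
apply: eq_bigr => i _; rewrite conjcM conjc_real -{1}(sqr_sqrtr (l0 i)).
by rewrite rmorphXn /=; ring.
Qed.

Lemma trace_diagonal (T I : finType) (s : T -> T -> C) (l : I -> R) (V : I -> T -> C) :
  ortho_family V -> diagonalizes s l V -> \sum_x s x x = (\sum_i l i)%:C.
Proof.
move=> oV dV; under eq_bigr do rewrite dV.
rewrite exchange_big rmorph_sum; apply: eq_bigr => i _ /=.
rewrite -mulr_sumr; under eq_bigr do rewrite mulrC.
by rewrite oV eqxx mulr1.
Qed.

End Operators.

(** * Monotonicity of relative entropies *)

Section LogApproximation.
Variable R : realType.

Lemma ln_le_subr1 (x : R) : 0 < x -> ln x <= x - 1.
Proof. by move=> x0; have := @le_ln1Dx R (x - 1); rewrite subrKC; apply; lra. Qed.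

Lemma ln_ge_1subrV (x : R) : 0 < x -> 1 - x^-1 <= ln x.
Proof.
move=> x0; have := @ln_le_subr1 x^-1; rewrite invr_gt0 lnV ?posrE // => /(_ x0); lra.
Qed.

Definition resolvent (s x : R) := (1 - s + s * x)^-1.

(** The nodes are the right endpoints s = (k + 1) / N, which avoids s = 0; the weight [k.+1%:R^-1]
    is the step 1 / N times the factor 1 / s of the integrand. *)
Definition ln_sum (N : nat) (x : R) :=
  \sum_(k < N) k.+1%:R^-1 * (1 - resolvent (k.+1%:R / N%:R) x).

(* Riemann sums of ln x = int_0^1 (x - 1) / (1 + s (x - 1)) ds, whose integrand is
   s^-1 (1 - resolvent s x). *)
Lemma ln_resolvent_bounds (x : R) (N : nat) : 0 < x -> (0 < N)%N ->
  ln_sum N x <= ln x <= ln_sum N x + (x - 1) ^+ 2 / x / N%:R.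
Proof.
move=> x0 N0; set r := ln_sum N x.
have NR : (0 : R) < N%:R by rewrite ltr0n.
(* [a k] is N times the denominator 1 + s (x - 1) at s = k / N. Then ln x telescopes along [a], and
   each increment lies between (x - 1) / a (k + 1) and (x - 1) / a k. *)
pose a k : R := N%:R + k%:R * (x - 1).
have a_gt0 j : (j <= N)%N -> 0 < a j.
  move=> jN; have -> : a j = (N - j)%:R + j%:R * x by rewrite /a natrB //; ring.
  case: j jN => [|j] jN; first by rewrite subn0 mul0r addr0.
  by rewrite ltr_wpDl ?ler0n // mulr_gt0 // ltr0n.
have lnxE : ln x = \sum_(k < N) (ln (a k.+1) - ln (a k)).
  rewrite -(big_mkord xpredT (fun k => ln (a k.+1) - ln (a k))) telescope_sumr //.
  have -> : a N = N%:R * x by rewrite /a; ring.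
  have -> : a 0%N = N%:R by rewrite /a; ring.
  by rewrite lnM ?posrE //; ring.
have rE : r = \sum_(k < N) (x - 1) / a k.+1.
  apply: eq_bigr => k _; rewrite /resolvent.
  have ak := a_gt0 _ (ltn_ord k); have k0 : (0 : R) < k.+1%:R by rewrite ltr0n.
  have -> : 1 - k.+1%:R / N%:R + k.+1%:R / N%:R * x = a k.+1 / N%:R.
    by rewrite /a; field; rewrite gt_eqF.
  by rewrite /a in ak *; field; rewrite !nat1r !gt_eqF.
have step j : (j < N)%N -> ln (a j.+1) - ln (a j) = ln (a j.+1 / a j).
  by move=> jN; rewrite ln_div ?posrE ?a_gt0 // ltnW.
have diff j : a j.+1 = a j + (x - 1) by rewrite /a -natr1; ring.
apply/andP; split.
- rewrite rE lnxE; apply: ler_sum => k _; rewrite step //.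
  have ak := a_gt0 _ (ltn_ord k); have ak' := a_gt0 _ (ltnW (ltn_ord k)).
  apply: le_trans (ln_ge_1subrV _); last by rewrite divr_gt0.
  rewrite invf_div [leRHS](_ : _ = (a k.+1 - a k) / a k.+1); last by field; rewrite gt_eqF.
  by have -> : a k.+1 - a k = x - 1 by rewrite diff; ring.
(* The left and right Riemann sums differ by a telescoping sum, equal to (x - 1) / N - (x - 1) / (N
   x). *)
- have -> : r + (x - 1) ^+ 2 / x / N%:R = \sum_(k < N) (x - 1) / a k.
    have -> : \sum_(k < N) (x - 1) / a k
        = r - \sum_(k < N) ((x - 1) / a k.+1 - (x - 1) / a k).
      by rewrite rE -sumrB; apply: eq_bigr => k _; ring.
    congr (_ + _).
    rewrite -(big_mkord xpredT (fun k => (x - 1) / a k.+1 - (x - 1) / a k)).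
    rewrite (telescope_sumr (fun k => (x - 1) / a k)) //.
    have -> : a N = N%:R * x by rewrite /a; ring.
    have -> : a 0%N = N%:R by rewrite /a; ring.
    by field; rewrite !gt_eqF.
  rewrite lnxE; apply: ler_sum => k _; rewrite step //.
  have ak := a_gt0 _ (ltn_ord k); have ak' := a_gt0 _ (ltnW (ltn_ord k)).
  apply: le_trans (ln_le_subr1 _) _; first by rewrite divr_gt0.
  rewrite [leLHS](_ : _ = (a k.+1 - a k) / a k); last by field; rewrite gt_eqF.
  by have -> : a k.+1 - a k = x - 1 by rewrite diff; ring.
Qed.

Lemma le_of_le_add_divn (X Y K : R) :
  (forall N, (0 < N)%N -> X <= Y + K / N%:R) -> X <= Y.
Proof.
move=> H; rewrite leNgt; apply/negP => YX.
have XY : 0 < X - Y by lra.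
have [N NK] : exists N : nat, `|K| / (X - Y) < N.+1%:R.
  exists (Num.bound (`|K| / (X - Y))).
  apply: lt_le_trans (archi_boundP _) _; first by rewrite divr_ge0 // ltW.
  by rewrite ler_nat.
have N0 : (0 : R) < N.+1%:R by rewrite ltr0n.
have := H N.+1 isT.
have : K / N.+1%:R < X - Y.
  rewrite ltr_pdivrMr //; move: NK; rewrite ltr_pdivrMr // mulrC.
  by apply: le_lt_trans; exact: ler_norm.
set t := K / _; lra.
Qed.

(** Resolvents enter [ln_sum] with a minus sign, which reverses the inequality; equal total weights
    cancel the constant terms, and the error of order 1 / N disappears in the limit. *)
Lemma sum_ln_le_of_resolvent (P P' : finType) (a x : P -> R) (a' x' : P' -> R) :
  (forall p, 0 <= a p) -> (forall p, a p != 0 -> 0 < x p) ->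
  (forall p, 0 <= a' p) -> (forall p, a' p != 0 -> 0 < x' p) ->
  \sum_p a p = \sum_p a' p ->
  (forall s, 0 < s <= 1 ->
     \sum_p a' p * resolvent s (x' p) <= \sum_p a p * resolvent s (x p)) ->
  \sum_p a p * ln (x p) <= \sum_p a' p * ln (x' p).
Proof.
move=> a0 ax a'0 ax' eqa H.
apply: (@le_of_le_add_divn _ _ (\sum_p a p * ((x p - 1) ^+ 2 / x p))) => N N0.
have swap (Q : finType) (b y : Q -> R) : \sum_p b p * ln_sum N (y p) =
    \sum_(k < N) k.+1%:R^-1 *
      (\sum_p b p - \sum_p b p * resolvent (k.+1%:R / N%:R) (y p)).
  under eq_bigr do rewrite mulr_sumr.
  rewrite exchange_big; apply: eq_bigr => k _ /=.
  by rewrite -sumrB mulr_sumr; apply: eq_bigr => p _; ring.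
apply: le_trans (_ : \sum_p a p * ln_sum N (x p) +
    (\sum_p a p * ((x p - 1) ^+ 2 / x p)) / N%:R <= _).
  rewrite mulr_suml -big_split /=; apply: ler_sum => p _.
  have [->|ap] := eqVneq (a p) 0; first by rewrite !mul0r addr0.
  have /andP [_ h] := ln_resolvent_bounds (ax _ ap) N0.
  by rewrite -mulrA -mulrDr ler_wpM2l.
rewrite lerD2r; apply: le_trans (_ : \sum_p a' p * ln_sum N (x' p) <= _).
  rewrite !swap; apply: ler_sum => k _; rewrite ler_wpM2l ?invr_ge0 ?ler0n //.
  rewrite eqa lerB // H // divr_gt0 ?ltr0n //=.
  by rewrite ler_pdivrMr ?ltr0n // mul1r ler_nat.
apply: ler_sum => p _.
have [->|ap] := eqVneq (a' p) 0; first by rewrite !mul0r.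
by have /andP [h _] := ln_resolvent_bounds (ax' _ ap) N0; rewrite ler_wpM2l.
Qed.

End LogApproximation.

(** * Variational formula for resolvents and data processing *)

Section RelativeEntropy.
Variable R : realType.
Local Notation C := (R[i]).
Local Notation "x %:C" := (real_complex R x).

Lemma sqnormE (z : C) : (sqnorm z)%:C = z * conjc z.
Proof.
by case: z => a b; rewrite /sqnorm /=; simpc; congr (_ +i* _)%C; ring.
Qed.

Lemma sqnorm_ge0 (z : C) : 0 <= sqnorm z.
Proof. by rewrite addr_ge0 // sqr_ge0. Qed.

Lemma sqnorm_eq0 (z : C) : sqnorm z = 0 -> z = 0.
Proof.
case: z => a b /eqP; rewrite /sqnorm /= paddr_eq0 ?sqr_ge0 // !sqrf_eq0.
by case/andP => /eqP -> /eqP ->.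
Qed.

Lemma sqnormMr (z : C) (r : R) : sqnorm (z * r%:C) = sqnorm z * r ^+ 2.
Proof. by case: z => a b; rewrite /sqnorm /=; ring. Qed.

Lemma sqnormM (y z : C) : sqnorm (y * z) = sqnorm y * sqnorm z.
Proof. by case: y => a b; case: z => c d; rewrite /sqnorm /=; ring. Qed.

Lemma sqnorm_conj (z : C) : sqnorm (conjc z) = sqnorm z.
Proof. by case: z => a b; rewrite /sqnorm /= sqrrN. Qed.

Lemma Re_sum (I : finType) (P : pred I) (F : I -> C) :
  complex.Re (\sum_(i | P i) F i) = \sum_(i | P i) complex.Re (F i).
Proof. exact: (@raddf_sum _ _ (@complex.Re R : Rcomplex R -> R)). Qed.

Lemma resolvent_gt0 (s x : R) : 0 < s <= 1 -> 0 < x -> 0 < 1 - s + s * x.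
Proof. by case/andP => s0 s1 x0; rewrite ltr_wpDl ?subr_ge0 ?mulr_gt0. Qed.

(** Completing the square: with q = 1 - s + s m / l, the right side exceeds the left by (l / q) |q y
    - u|^2. If |u|^2 l = 0, the linear term vanishes and the rest is nonpositive. *)
Lemma resolvent_variational (u y : C) (l m s : R) :
  0 <= l -> 0 <= m -> 0 < s <= 1 -> (sqnorm u * l != 0 -> 0 < m) ->
  2 * (l * complex.Re (conjc y * u)) - ((1 - s) * (l * sqnorm y) + s * (m * sqnorm y))
    <= sqnorm u * l * resolvent s (m / l).
Proof.
move=> l0 m0 s01 sup; have /andP [s0 s1] := s01.
have y0 := sqnorm_ge0 y.
have neg : 0 <= (1 - s) * (l * sqnorm y) + s * (m * sqnorm y).
  by rewrite addr_ge0 // !mulr_ge0 // ?subr_ge0 // ltW.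
have [u0|ul] := eqVneq (sqnorm u * l) 0.
  rewrite u0 mul0r; suff -> : l * complex.Re (conjc y * u) = 0 by lra.
  move/eqP: u0; rewrite mulf_eq0 => /orP [/eqP /sqnorm_eq0 ->|/eqP ->].
    by rewrite !mulr0.
  by rewrite !mul0r.
have mp := sup ul.
have lp : 0 < l by rewrite lt_def l0 andbT; apply: contraNneq ul => ->; rewrite mulr0.
have q0 := resolvent_gt0 s01 (divr_gt0 mp lp).
rewrite /resolvent; set q := 1 - s + s * (m / l) in q0 *.
have -> : (1 - s) * (l * sqnorm y) + s * (m * sqnorm y) = l * q * sqnorm y.
  by rewrite /q; field; rewrite gt_eqF.
case: u {ul sup} => c d; case: y {y0 neg} => a b; rewrite /sqnorm /=.
rewrite -subr_ge0.
have -> : (c ^+ 2 + d ^+ 2) * l / q -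
   (2 * (l * (a * c - - b * d)) - l * q * (a ^+ 2 + b ^+ 2)) =
   l / q * ((q * a - c) ^+ 2 + (q * b - d) ^+ 2).
  by field; rewrite gt_eqF.
by rewrite mulr_ge0 ?addr_ge0 ?sqr_ge0 // divr_ge0 // ltW.
Qed.

Lemma resolvent_attained (u : C) (l m s : R) :
  0 <= l -> 0 < s <= 1 -> (sqnorm u * l != 0 -> 0 < m) ->
  exists y : C,
  2 * (l * complex.Re (conjc y * u)) - ((1 - s) * (l * sqnorm y) + s * (m * sqnorm y))
    = sqnorm u * l * resolvent s (m / l).
Proof.
move=> l0 s01 sup.
have [u0|ul] := eqVneq (sqnorm u * l) 0.
  by exists (Complex 0 0); rewrite u0; case: (u) => a b; rewrite /sqnorm /=; ring.
have mp := sup ul.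
have lp : 0 < l by rewrite lt_def l0 andbT; apply: contraNneq ul => ->; rewrite mulr0.
have := resolvent_gt0 s01 (divr_gt0 mp lp).
rewrite /resolvent; set q := 1 - s + s * (m / l) => q0.
(* The zero y = u / q of the completed square. *)
exists (u * (q^-1)%:C); rewrite sqnormMr.
have -> : m = (l * q - (1 - s) * l) / s.
  by rewrite /q; field; rewrite !gt_eqF //; case/andP: s01.
have sn0 : s != 0 by rewrite gt_eqF //; case/andP: s01.
by case: u {ul sup} => a b; rewrite /sqnorm /=; field; rewrite sn0 gt_eqF.
Qed.

(* Data processing for relative entropies given by spectral data: u p is the overlap of
   the eigenvectors indexed by p, with eigenvalues l p and m p. By the variational
   formula for the resolvents, it is enough to lift test operators y'. *)
Lemma relative_entropy_monotone (P P' : finType) (u : P -> C) (l m : P -> R)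
    (u' : P' -> C) (l' m' : P' -> R) :
  (forall p, 0 <= l p) -> (forall p, 0 <= m p) ->
  (forall p, sqnorm (u p) * l p != 0 -> 0 < m p) ->
  (forall p, 0 <= l' p) -> (forall p, 0 <= m' p) ->
  (forall p, sqnorm (u' p) * l' p != 0 -> 0 < m' p) ->
  \sum_p sqnorm (u p) * l p = \sum_p sqnorm (u' p) * l' p ->
  (forall y' : P' -> C, exists y : P -> C,
    [/\ \sum_p (l p)%:C * (conjc (y p) * u p) = \sum_p (l' p)%:C * (conjc (y' p) * u' p),
        \sum_p l p * sqnorm (y p) <= \sum_p l' p * sqnorm (y' p)
      & \sum_p m p * sqnorm (y p) <= \sum_p m' p * sqnorm (y' p)]) ->
  \sum_p sqnorm (u p) * l p * ln (m p / l p)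
    <= \sum_p sqnorm (u' p) * l' p * ln (m' p / l' p).
Proof.
move=> l0 m0 sup l'0 m'0 sup' tr lift.
have pos (Q : finType) (v : Q -> C) (a b : Q -> R) p : (forall p, 0 <= a p) ->
    (forall p, sqnorm (v p) * a p != 0 -> 0 < b p) ->
    sqnorm (v p) * a p != 0 -> 0 < b p / a p.
  move=> a0 s h; rewrite divr_gt0 ?s // lt_def a0 andbT.
  by apply: contraNneq h => ->; rewrite mulr0.
apply: sum_ln_le_of_resolvent => //.
- by move=> p; rewrite mulr_ge0 ?sqnorm_ge0.
- by move=> p; exact: pos.
- by move=> p; rewrite mulr_ge0 ?sqnorm_ge0.
- by move=> p; exact: pos.
move=> s s01; have /andP [s0 s1] := s01.
(* The optimal y' turns the primed side into its variational value; the lift of y' is then one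
   admissible choice for the other side. *)
have [y' y'E] := fin_all_exists (fun p => @resolvent_attained (u' p) _ (m' p) s (l'0 p) s01 (sup' p)).
have [y [e1 e2 e3]] := lift y'.
under eq_bigr do rewrite -y'E.
apply: le_trans (ler_sum _ (fun p _ => @resolvent_variational (u p) (y p) _ _ s (l0 p) (m0 p) s01 (sup p))).
rewrite !sumrB !big_split /= -!mulr_sumr.
have ReE (Q : finType) (a : Q -> R) (v w : Q -> C) :
    \sum_p a p * complex.Re (conjc (v p) * w p) =
    complex.Re (\sum_p (a p)%:C * (conjc (v p) * w p)).
  rewrite Re_sum; apply: eq_bigr => p _.
  by case: (conjc _ * _) => x z /=; rewrite mul0r subr0.
rewrite !ReE e1 lerB // lerD // ler_wpM2l // ?subr_ge0 // ltW //.
Qed.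

End RelativeEntropy.

(** * The uncertainty relation for a state on three systems *)

Section ProductSpaces.
Variable R : realType.
Local Notation C := (R[i]).
Local Notation "x %:C" := (real_complex R x).

Definition mxapp (T : finType) (M : T -> T -> C) (h : T -> C) : T -> C :=
  fun x => \sum_y M x y * h y.

Definition delta_fun (T : finType) (x y : T) : C := (x == y)%:R.

Lemma mxapp_delta (T : finType) (h : T -> C) : mxapp (@delta_fun T) h =1 h.
Proof.
move=> x; rewrite /mxapp /delta_fun (bigD1 x) //= eqxx mul1r big1 ?addr0 // => y.
by rewrite eq_sym => /negPf ->; rewrite mul0r.
Qed.

Lemma eq_qf_fun (T : finType) (s : T -> T -> C) f1 g1 f2 g2 :
  f1 =1 f2 -> g1 =1 g2 -> qf s f1 g1 = qf s f2 g2.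
Proof.
by move=> ef eg; apply: eq_bigr => x _; apply: eq_bigr => y _; rewrite ef eg.
Qed.

(** Both sides are the trace of M^* s N, once in the basis w and once in the computational basis. *)
Lemma qf_basis_sum (T I : finType) (s M N : T -> T -> C) (w : I -> T -> C) :
  complete w ->
  \sum_q qf s (mxapp M (w q)) (mxapp N (w q)) = \sum_z qf s (M^~ z) (N^~ z).
Proof.
move=> cw; rewrite /qf exchange_big [RHS]exchange_big; apply: eq_bigr => x _ /=.
rewrite exchange_big [RHS]exchange_big; apply: eq_bigr => y _ /=.
transitivity (s x y * \sum_q ip (fun z => conjc (N y z)) (w q) *
                             ip (w q) (fun z => conjc (M x z))).
  rewrite mulr_sumr; apply: eq_bigr => q _; rewrite /mxapp conjc_sum /ip.
  rewrite [X in X * _ * _](eq_bigr (fun z => conjc (w q z) * conjc (M x z))); last first.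
    by move=> z _; rewrite conjcM mulrC.
  under [X in _ = _ * (X * _)]eq_bigr do rewrite conjcK.
  by ring.
rewrite (parseval _ _ cw) mulr_sumr; apply: eq_bigr => z _.
by rewrite conjcK; ring.
Qed.

Lemma sum_prod (A B : finType) (M : nmodType) (f : A * B -> M) :
  \sum_p f p = \sum_a \sum_b f (a, b).
Proof. by rewrite pair_bigA; apply: eq_bigr => -[]. Qed.

Variables J K F G : finType.
Variable psi : J * K * F -> G -> C.
Variable z : J -> J -> C.

Definition tens (k : J) (f : K * F -> C) : J * K * F -> C :=
  fun x => z k x.1.1 * f (x.1.2, x.2).

(** The vector |j> (x) h (x) |f>, with j and f in the computational bases. *)
Definition emb (j : J) (f : F) (h : K -> C) : J * K * F -> C :=
  fun x => (x.1.1 == j)%:R * (x.2 == f)%:R * h x.1.2.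

Definition emb2 (f : F) (h : K -> C) : K * F -> C :=
  fun y => (y.2 == f)%:R * h y.1.

(** Its Gram kernel is the unnormalized state on K F after outcome k of Z. In the same way
    [blockK j] gives the state on K after outcome j of X, and [margK] the reduced state on K. *)
Definition blockKF (k : J) : K * F -> G -> C :=
  fun y g => \sum_j conjc (z k j) * psi (j, y.1, y.2) g.

Definition blockK (j : J) : K -> F * G -> C := fun b t => psi (j, b, t.1) t.2.

Definition margK : K -> J * (F * G) -> C := fun b t => psi (t.1, b, t.2.1) t.2.2.

Lemma ip_tens k f g : ip (tens k f) (psi^~ g) = ip f ((blockKF k)^~ g).
Proof.
rewrite /ip !sum_prod exchange_big; apply: eq_bigr => b _ /=.
rewrite exchange_big; apply: eq_bigr => f' _ /=.
rewrite /blockKF mulr_sumr; apply: eq_bigr => j _.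
by rewrite /tens conjcM /=; ring.
Qed.

Lemma qf_tens k f g : qf (gram psi) (tens k f) (tens k g) = qf (gram (blockKF k)) f g.
Proof.
rewrite !qf_gram; apply: eq_bigr => c _.
by rewrite ip_tens -[ip (psi^~ c) _]conj_ip ip_tens conj_ip.
Qed.

Lemma sum_delta (T : finType) (t : T) (f : T -> C) : \sum_x (x == t)%:R * f x = f t.
Proof.
by rewrite (bigD1 t) //= eqxx mul1r big1 ?addr0 // => x /negPf ->; rewrite mul0r.
Qed.

Lemma conjc_bool (b : bool) : conjc (b%:R : C) = b%:R.
Proof. by rewrite conjc_nat. Qed.

Lemma ip_emb j f h (g : J * K * F -> C) :
  ip (emb j f h) g = ip h (fun b => g (j, b, f)).
Proof.
rewrite /ip !sum_prod exchange_big /=; apply: eq_bigr => b _.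
rewrite -(sum_delta j (fun j' => conjc (h b) * g (j', b, f))); apply: eq_bigr => j' _.
rewrite -(sum_delta f (fun f' => conjc (h b) * g (j', b, f'))) mulr_sumr.
apply: eq_bigr => f' _; rewrite /emb /= !conjcM !conjc_bool; ring.
Qed.

Lemma ip_emb2 f h (g : K * F -> C) : ip (emb2 f h) g = ip h (fun b => g (b, f)).
Proof.
rewrite /ip !sum_prod; apply: eq_bigr => b _.
rewrite -(sum_delta f (fun f' => conjc (h b) * g (b, f'))).
by apply: eq_bigr => f' _; rewrite /emb2 /= conjcM conjc_bool; ring.
Qed.

Lemma qf_emb_sum j h g :
  \sum_f qf (gram psi) (emb j f h) (emb j f g) = qf (gram (blockK j)) h g.
Proof.
rewrite qf_gram sum_prod; apply: eq_bigr => f _; rewrite qf_gram; apply: eq_bigr => c _.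
by rewrite ip_emb -[ip (psi^~ c) _]conj_ip ip_emb conj_ip.
Qed.

Lemma ip_emb_tens j f h k g : ip (emb j f h) (tens k g) = z k j * ip (emb2 f h) g.
Proof.
by rewrite ip_emb ip_emb2 /ip mulr_sumr; apply: eq_bigr => b _; rewrite /tens /=; ring.
Qed.

Lemma qf_margK h g : qf (gram margK) h g = \sum_j qf (gram (blockK j)) h g.
Proof.
by rewrite qf_gram sum_prod; apply: eq_bigr => j _; rewrite qf_gram.
Qed.

(** Measuring Z on J leaves the reduced state on K unchanged: for each f and each environment index
    this is Parseval in z. *)
Lemma qf_emb2_sum h : complete z ->
  \sum_f \sum_k qf (gram (blockKF k)) (emb2 f h) (emb2 f h) = qf (gram margK) h h.
Proof.
move=> cz; rewrite qf_margK.
under [RHS]eq_bigr do rewrite -qf_emb_sum.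
rewrite [RHS]exchange_big; apply: eq_bigr => f _ /=.
under eq_bigr do rewrite qf_gram.
under [RHS]eq_bigr do rewrite qf_gram.
rewrite exchange_big [RHS]exchange_big; apply: eq_bigr => c _ /=.
pose t j := ip h (fun b => psi (j, b, f) c).
have e1 k : ip (emb2 f h) ((blockKF k)^~ c) = ip (z k) t.
  rewrite ip_emb2 /ip /blockKF /t /=.
  under eq_bigr do rewrite mulr_sumr.
  rewrite exchange_big; apply: eq_bigr => j _ /=.
  by rewrite mulr_sumr; apply: eq_bigr => b _; ring.
transitivity (\sum_k ip t (z k) * ip (z k) t).
  by apply: eq_bigr => k _; rewrite e1 -[ip (_^~ c) _]conj_ip e1 conj_ip mulrC.
rewrite (parseval _ _ cz); apply: eq_bigr => j _.
by rewrite ip_emb -[ip (_^~ c) _]conj_ip ip_emb -/(t j) mulrC.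
Qed.

End ProductSpaces.

(** * Lifting test operators from X B to A B F *)

Section SpectralLift.
Variable R : realType.
Local Notation C := (R[i]).
Local Notation "x %:C" := (real_complex R x).

Lemma sqnorm_ip (T : finType) (f g : T -> C) : (sqnorm (ip f g))%:C = ip f g * ip g f.
Proof. by rewrite sqnormE conj_ip. Qed.

Lemma ip_suml (T I : finType) (a : I -> C) (f : I -> T -> C) g :
  ip (fun x => \sum_i a i * f i x) g = \sum_i conjc (a i) * ip (f i) g.
Proof.
rewrite /ip; under [RHS]eq_bigr do rewrite mulr_sumr.
rewrite exchange_big; apply: eq_bigr => x _ /=.
rewrite conjc_sum mulr_suml; apply: eq_bigr => i _.
by rewrite conjcM mulrA.
Qed.

Lemma ip_sum_orthonormal (T I : finType) (a : I -> C) (f : I -> T -> C) j :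
  ortho_family f -> ip (fun x => \sum_i a i * f i x) (f j) = conjc (a j).
Proof.
move=> of_; rewrite ip_suml (bigD1 j) //= [ip _ _]of_ eqxx mulr1 big1 ?addr0 // => i ij.
by rewrite [ip _ _]of_ (negPf ij) mulr0.
Qed.

Lemma qf_sum_eigen (T I : finType) (s : T -> T -> C) (l : I -> R) (V : I -> T -> C)
    (a : I -> C) :
  ortho_family V -> diagonalizes s l V ->
  qf s (fun x => \sum_i a i * V i x) (fun x => \sum_i a i * V i x) =
  (\sum_i l i * sqnorm (a i))%:C.
Proof.
move=> oV dV; rewrite (qf_diagonal _ _ dV) rmorph_sum; apply: eq_bigr => i _ /=.
rewrite rmorphM /= sqnormE -[ip (V i) _]conj_ip ip_sum_orthonormal // conjcK.
by rewrite [conjc _ * _]mulrC.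
Qed.

Lemma sum_eigenvalues_sqnorm (T I : finType) (s : T -> T -> C) (l : I -> R)
    (V : I -> T -> C) f :
  diagonalizes s l V -> (\sum_i l i * sqnorm (ip (V i) f))%:C = qf s f f.
Proof.
move=> dV; rewrite (qf_diagonal _ _ dV) rmorph_sum; apply: eq_bigr => i _ /=.
by rewrite rmorphM /= sqnorm_ip [X in _ * X]mulrC.
Qed.

Lemma sum_sqnorm_ip (T I : finType) (V : I -> T -> C) f :
  complete V -> (\sum_i sqnorm (ip (V i) f))%:C = ip f f.
Proof.
move=> cV; rewrite -(parseval _ _ cV) rmorph_sum; apply: eq_bigr => i _ /=.
by rewrite sqnorm_ip mulrC.
Qed.

Variables J K F G : finType.
Variable psi : J * K * F -> G -> C.
Variable z : J -> J -> C.
Hypothesis cz : complete z.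
Variables (l : J * K * F -> R) (v : J * K * F -> J * K * F -> C).
Hypotheses (ov : ortho_family v) (cv : complete v) (dv : diagonalizes (gram psi) l v).
Variables (mu : J -> K * F -> R) (s : J -> K * F -> K * F -> C).
Hypotheses (os : forall k, ortho_family (s k)) (cs : forall k, complete (s k)).
Hypothesis ds : forall k, diagonalizes (gram (blockKF psi z k)) (mu k) (s k).
Variables (lr : J -> K -> R) (r : J -> K -> K -> C).
Hypotheses (or : forall j, ortho_family (r j)) (cr : forall j, complete (r j)).
Hypothesis dr : forall j, diagonalizes (gram (blockK psi j)) (lr j) (r j).
Variables (nu : K -> R) (be : K -> K -> C).
Hypotheses (obe : ortho_family be) (cbe : complete be).
Hypothesis dbe : diagonalizes (gram (margK psi)) nu be.
Variable c : J -> R.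
Hypothesis zc : forall j k, sqnorm (z k j) <= c j.

(** Eigenbasis of the Z-pinching of rho_ABF, with eigenvalues [mu k q]: z k tensored with the
    eigenvectors of the conditional state of outcome k. Here A and B are J and K, and rho_ABF is the
    Gram kernel of psi. *)
Definition tens_basis (kq : J * (K * F)) := tens z kq.1 (s kq.1 kq.2).
Local Notation w := tens_basis.

Lemma complete_tens_basis : complete w.
Proof.
case=> -[j b] f [[j' b'] f']; rewrite sum_prod.
transitivity (\sum_k z k j * conjc (z k j') * ((b, f) == (b', f'))%:R).
  apply: eq_bigr => k _; rewrite -(cs k) mulr_sumr; apply: eq_bigr => q _.
  by rewrite /w /tens /= conjcM; ring.
by rewrite -mulr_suml cz !xpair_eqE -!mulnb !natrM mulrA.
Qed.

Section Lift.
Variable y' : J * (K * K) -> C.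

Definition test_vec j a' : K -> C := fun b => \sum_a y' (j, (a, a')) * r j a b.

Definition test_block j b b' : C := \sum_a' test_vec j a' b * conjc (be a' b').

(* The test operator sum_j |x_j><x_j| (x) Y_j (x) 1_F, where (x_j) is the computational basis
   of J and Y_j = sum_{a,a'} y'(j,a,a') |r_j a><be a'|. *)
Definition test_op : J * K * F -> J * K * F -> C :=
  fun x x' => emb x'.1.1 x'.2 ((test_block x'.1.1)^~ x'.1.2) x.

Lemma mxapp_test_block j a' : mxapp (test_block j) (be a') =1 test_vec j a'.
Proof.
move=> b; rewrite /mxapp /test_block.
under eq_bigr do rewrite mulr_suml.
rewrite exchange_big (bigD1 a') //= [X in _ + X]big1 ?addr0 => [|a aa].
  under eq_bigr do rewrite -mulrA.
  by rewrite -mulr_sumr obe eqxx mulr1.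
under eq_bigr do rewrite -mulrA.
by rewrite -mulr_sumr obe (negPf aa) mulr0.
Qed.

Lemma delta_emb (x' : J * K * F) :
  (@delta_fun R _)^~ x' =1 emb x'.1.1 x'.2 ((@delta_fun R _)^~ x'.1.2).
Proof.
case: x' => -[j b] f [[j1 b1] f1]; rewrite /delta_fun /emb /=.
by rewrite !xpair_eqE -!mulnb !natrM; ring.
Qed.

(** Matrix elements of the test operator between the eigenbases of rho_ABF and of its pinching. *)
Definition lift_coef (p : (J * K * F) * (J * (K * F))) : C :=
  ip (v p.1) (mxapp test_op (w p.2)).

(** Both sides are the trace of rho Y^*. In the computational basis Y is block diagonal on J and
    trivial on F, so only the kernels of [blockK j] appear; each block trace is then read in the
    basis be. *)
Lemma lift_linear :
  \sum_p (l p.1)%:C * (conjc (lift_coef p) * ip (v p.1) (w p.2)) =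
  \sum_p (lr p.1 p.2.1)%:C * (conjc (y' p) * ip (r p.1 p.2.1) (be p.2.2)).
Proof.
rewrite sum_prod exchange_big /=.
transitivity (\sum_q qf (gram psi) (mxapp test_op (w q)) (mxapp (@delta_fun R _) (w q))).
  apply: eq_bigr => q _; rewrite (eq_qf_fun _ (frefl _) (mxapp_delta _)).
  rewrite (qf_diagonal _ _ dv); apply: eq_bigr => i _.
  by rewrite conj_ip.
rewrite (qf_basis_sum _ _ _ complete_tens_basis).
rewrite (eq_bigr (fun x' => qf (gram psi) (test_op^~ x')
  (emb x'.1.1 x'.2 ((@delta_fun R _)^~ x'.1.2)))); last first.
  by move=> x' _; apply: eq_qf_fun => //; exact: delta_emb.
rewrite !sum_prod; apply: eq_bigr => j _ /=.
transitivity (\sum_b qf (gram (blockK psi j)) ((test_block j)^~ b) ((@delta_fun R _)^~ b)).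
  by apply: eq_bigr => b _; rewrite -qf_emb_sum.
rewrite -(qf_basis_sum _ _ _ cbe).
rewrite sum_prod /= [RHS]exchange_big; apply: eq_bigr => a' _.
rewrite (eq_qf_fun _ (mxapp_test_block _ _) (mxapp_delta _)).
rewrite (qf_diagonal _ _ (dr j)); apply: eq_bigr => a _.
by rewrite ip_sum_orthonormal.
Qed.

(** The same reduction for the trace of rho Y Y^*, exact because this operator is again block
    diagonal on J and trivial on F. *)
Lemma lift_left :
  \sum_p l p.1 * sqnorm (lift_coef p) = \sum_p lr p.1 p.2.1 * sqnorm (y' p).
Proof.
apply: complexI; rewrite sum_prod exchange_big /= raddf_sum /=.
rewrite (eq_bigr (fun q => qf (gram psi) (mxapp test_op (w q)) (mxapp test_op (w q)))); last first.
  by move=> q _; rewrite -(sum_eigenvalues_sqnorm _ dv).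
rewrite (qf_basis_sum _ _ _ complete_tens_basis).
rewrite !sum_prod raddf_sum; apply: eq_bigr => j _ /=.
transitivity (\sum_b qf (gram (blockK psi j)) ((test_block j)^~ b) ((test_block j)^~ b)).
  by apply: eq_bigr => b _; rewrite -qf_emb_sum.
rewrite -(qf_basis_sum _ _ _ cbe).
rewrite sum_prod /= [in RHS]exchange_big raddf_sum; apply: eq_bigr => a' _ /=.
rewrite (eq_qf_fun _ (mxapp_test_block _ _) (mxapp_test_block _ _)).
exact: (qf_sum_eigen (fun a => y' (j, (a, a'))) (or j) (dr j)).
Qed.

(** This concerns the trace of sigma Y^* Y for the pinching sigma. Row (j, b, f) of Y meets z k with
    weight |z k j|^2, and bounding this by c j is the only loss. The sum over k and f then leaves
    rho_B by [qf_emb2_sum], diagonal in be. *)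
Lemma lift_right :
  \sum_p mu p.2.1 p.2.2 * sqnorm (lift_coef p)
    <= \sum_p c p.1 * nu p.2.2 * sqnorm (y' p).
Proof.
rewrite -lecR sum_prod exchange_big /=.
(* [h j b] is Y_j^* applied to the basis vector b. *)
pose h j b : K -> C := fun b' => conjc (test_block j b b').
have opE x : (fun x' => conjc (test_op x x')) =1 emb x.1.1 x.2 (h x.1.1 x.1.2).
  move=> x'; rewrite /test_op /emb /h !conjcM !conjc_bool.
  rewrite ![_ == x.1.1]eq_sym ![_ == x.2]eq_sym.
  by case: eqP => [->|_] //; rewrite !mul0r.
have -> : (\sum_q \sum_i mu q.1 q.2 * sqnorm (lift_coef (i, q)))%:C =
    \sum_j \sum_b \sum_f \sum_k (sqnorm (z k j))%:C *
      qf (gram (blockKF psi z k)) (emb2 f (h j b)) (emb2 f (h j b)).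
  transitivity (\sum_q (mu q.1 q.2)%:C *
     \sum_x (sqnorm (ip (emb x.1.1 x.2 (h x.1.1 x.1.2)) (w q)))%:C).
    rewrite raddf_sum; apply: eq_bigr => q _ /=.
    rewrite -mulr_sumr rmorphM /= (sum_sqnorm_ip (mxapp test_op (w q)) cv) [ip]/ip; congr (_ * _).
    apply: eq_bigr => x _; rewrite mulrC -sqnormE; congr (sqnorm _)%:C.
    rewrite /mxapp; apply: eq_bigr => x' _; rewrite -opE conjcK //.
  under eq_bigr do rewrite mulr_sumr.
  rewrite exchange_big !sum_prod; apply: eq_bigr => j _; apply: eq_bigr => b _.
  apply: eq_bigr => f _; rewrite sum_prod; apply: eq_bigr => k _ /=.
  rewrite -(sum_eigenvalues_sqnorm _ (ds k)) rmorph_sum mulr_sumr.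
  apply: eq_bigr => q _ /=; rewrite ip_emb_tens sqnormM !rmorphM /=.
  by rewrite -[in RHS](sqnorm_conj (ip (s k q) _)) conj_ip; ring.
apply: le_trans (_ : \sum_j \sum_b (c j)%:C * qf (gram (margK psi)) (h j b) (h j b) <= _).
  apply: ler_sum => j _; apply: ler_sum => b _.
  rewrite -(qf_emb2_sum _ _ cz) mulr_sumr; apply: ler_sum => f _.
  rewrite mulr_sumr; apply: ler_sum => k _.
  by rewrite ler_wpM2r ?qf_gram_ge0 // lecR.
rewrite sum_prod raddf_sum; apply: ler_sum => j _ /=.
rewrite -mulr_sumr (eq_bigr (fun b => qf (gram (margK psi))
  ((fun b' b => conjc (test_block j b b'))^~ b)
  ((fun b' b => conjc (test_block j b b'))^~ b))) //.
rewrite -(qf_basis_sum _ _ _ (cr j)) sum_prod rmorph_sum mulr_sumr.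
apply: ler_sum => a _ /=.
have appE : mxapp (fun b' b => conjc (test_block j b b')) (r j a) =1
    (fun b' => \sum_a' conjc (y' (j, (a, a'))) * be a' b').
  move=> b'; rewrite /mxapp /test_block.
  under eq_bigr do rewrite conjc_sum mulr_suml.
  rewrite exchange_big; apply: eq_bigr => a' _ /=.
  rewrite -(ip_sum_orthonormal (fun a => y' (j, (a, a'))) a (or j)) /ip mulr_suml.
  by apply: eq_bigr => b _; rewrite conjcM conjcK /test_vec; ring.
rewrite (eq_qf_fun _ appE appE) (qf_sum_eigen _ obe dbe) -rmorphM /= lecR mulr_sumr.
by apply: ler_sum => a' _; rewrite sqnorm_conj mulrA.
Qed.

End Lift.
End SpectralLift.

(** * The tripartite entropic inequality *)

Section UncertaintyCore.
Variable R : realType.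
Local Notation C := (R[i]).
Local Notation "x %:C" := (real_complex R x).

Lemma ln2_gt0 : 0 < ln 2 :> R.
Proof. by rewrite ln_gt0 // ltr1n. Qed.

Lemma xlnx_etaf (x : R) : x * ln x = - (ln 2 * etaf x).
Proof. by rewrite /etaf /log2; field; rewrite gt_eqF ?ln2_gt0. Qed.

(** The m q are the diagonal elements of the first state in the second basis, as for a pinching, so
    minus the relative entropy reduces to a difference of entropies. The support condition holds
    since m q is a sum of nonnegative terms, one of them the given one. *)
Lemma sum_relative_entropy (I Q : finType) (u : I -> Q -> C) (l : I -> R) (m : Q -> R) :
  (forall i, 0 <= l i) -> (forall i, \sum_q sqnorm (u i q) = 1) ->
  (forall q, \sum_i sqnorm (u i q) * l i = m q) ->
  (forall i q, sqnorm (u i q) * l i != 0 -> 0 < m q) /\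
  \sum_i \sum_q sqnorm (u i q) * l i * ln (m q / l i) =
    ln 2 * (\sum_i etaf (l i) - \sum_q etaf (m q)).
Proof.
move=> l0 u1 um.
have t0 i q : 0 <= sqnorm (u i q) * l i by rewrite mulr_ge0 ?sqnorm_ge0.
have m_gt0 i q : sqnorm (u i q) * l i != 0 -> 0 < m q.
  move=> h; rewrite -um (bigD1 i) //= ltr_pwDl //; first by rewrite lt_def h t0.
  by apply: sumr_ge0.
split=> //.
transitivity (\sum_i \sum_q (sqnorm (u i q) * l i * ln (m q) - sqnorm (u i q) * l i * ln (l i))).
  apply: eq_bigr => i _; apply: eq_bigr => q _.
  have [->|h] := eqVneq (sqnorm (u i q) * l i) 0; first by rewrite !mul0r subrr.
  rewrite ln_div ?posrE ?(m_gt0 i) // ?mulrBr //.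
  by rewrite lt_def l0 andbT; apply: contraNneq h => ->; rewrite mulr0.
under eq_bigr do rewrite sumrB.
rewrite sumrB mulrBr addrC; congr (_ + _).
  rewrite mulr_sumr -sumrN; apply: eq_bigr => i _.
  under eq_bigr do rewrite -mulrA.
  by rewrite -mulr_suml u1 mul1r xlnx_etaf opprK.
rewrite exchange_big mulr_sumr -sumrN; apply: eq_bigr => q _ /=.
by rewrite -mulr_suml um xlnx_etaf.
Qed.

Lemma sqnorm_ip_marginal (T I : finType) (s : T -> T -> C) (l : I -> R) (V : I -> T -> C) f :
  diagonalizes s l V -> (\sum_i sqnorm (ip (V i) f) * l i)%:C = qf s f f.
Proof.
move=> dV; rewrite -(sum_eigenvalues_sqnorm _ dV); congr (_ %:C).
by apply: eq_bigr => i _; rewrite mulrC.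
Qed.

Variables J K F G : finType.
Variable psi : J * K * F -> G -> C.
Variable z : J -> J -> C.

(* X is the computational basis of J, and z k is the k-th vector of the basis Z. *)
Theorem entropic_uncertainty (c : J -> R) :
  complete z -> (forall j k, sqnorm (z k j) <= c j) ->
  vN (gram (margK psi)) + vN (gram psi)
    + \sum_j complex.Re (\sum_b gram (blockK psi j) b b) * log2 (1 / c j)
  <= \sum_k vN (gram (blockKF psi z k)) + \sum_j vN (gram (blockK psi j)).
Proof.
move=> cz zc.
(* Otherwise all z k j vanish, against completeness at (j, j). *)
have c_gt0 j : 0 < c j.
  rewrite ltNge; apply/negP => cj0; have := cz j j; rewrite eqxx big1.
    by move/eqP; rewrite eq_sym oner_eq0.
  move=> k _; rewrite (@sqnorm_eq0 _ (z k j)) ?mul0r //.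
  by apply/eqP; rewrite eq_le sqnorm_ge0 (le_trans (zc j k)).
have [l [v [l0 ov cv dv ->]]] := gram_diagonalization psi.
have [nu [be [nu0 obe cbe dbe ->]]] := gram_diagonalization (margK psi).
(* Eigenvalues and eigenvectors are packed into a pair so that one finite choice selects them for
   all k. *)
have [ms msP] := fin_all_exists (fun k => let: ex_intro l (ex_intro V h) :=
  gram_diagonalization (blockKF psi z k) in ex_intro (fun p : _ * _ =>
    [/\ forall i, 0 <= p.1 i, ortho_family p.2, complete p.2,
     diagonalizes (gram (blockKF psi z k)) p.1 p.2
     & vN (gram (blockKF psi z k)) = \sum_i etaf (p.1 i)]) (l, V) h).
have [lr lrP] := fin_all_exists (fun j => let: ex_intro l (ex_intro V h) :=
  gram_diagonalization (blockK psi j) in ex_intro (fun p : _ * _ =>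
    [/\ forall i, 0 <= p.1 i, ortho_family p.2, complete p.2,
     diagonalizes (gram (blockK psi j)) p.1 p.2
     & vN (gram (blockK psi j)) = \sum_i etaf (p.1 i)]) (l, V) h).
pose mu k := (ms k).1; pose s k := (ms k).2; pose la j := (lr j).1; pose r j := (lr j).2.
have mu0 k q : 0 <= mu k q by have [h _ _ _ _] := msP k; exact: h.
have os k : ortho_family (s k) by have [] := msP k.
have cs k : complete (s k) by have [] := msP k.
have ds k : diagonalizes (gram (blockKF psi z k)) (mu k) (s k) by have [] := msP k.
have la0 j a : 0 <= la j a by have [h _ _ _ _] := lrP j; exact: h.
have or j : ortho_family (r j) by have [] := lrP j.
have cr j : complete (r j) by have [] := lrP j.
have dr j : diagonalizes (gram (blockK psi j)) (la j) (r j) by have [] := lrP j.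
have -> : \sum_k vN (gram (blockKF psi z k)) = \sum_k \sum_q etaf (mu k q).
  by apply: eq_bigr => k _; have [] := msP k.
have -> : \sum_j vN (gram (blockK psi j)) = \sum_j \sum_a etaf (la j a).
  by apply: eq_bigr => j _; have [] := lrP j.
pose w := tens_basis z s.
have cw : complete w by exact: complete_tens_basis.
have one1 (T I : finType) (f : T -> C) (V : I -> T -> C) : ip f f = 1 -> complete V ->
    \sum_q sqnorm (ip f (V q)) = 1.
  move=> f1 cV; apply: complexI; rewrite rmorph1 -f1 -(sum_sqnorm_ip _ cV).
  by congr (_ %:C); apply: eq_bigr => q _; rewrite -conj_ip sqnorm_conj.
have v1 i : \sum_q sqnorm (ip (v i) (w q)) = 1 by apply: one1 => //; rewrite [LHS]ov eqxx.
have muE q : \sum_i sqnorm (ip (v i) (w q)) * l i = mu q.1 q.2.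
  apply: complexI; rewrite (sqnorm_ip_marginal _ dv) qf_tens.
  by rewrite (qf_eigen _ _ (os _) (ds _)) eqxx mulr1.
have [sup1 sum1] := sum_relative_entropy l0 v1 muE.
(* rho_B is the sum of the X-conditional states, so its eigenvalues are sums of their diagonal
   elements in be. *)
have nuE a' : \sum_(p : J * K) sqnorm (ip (r p.1 p.2) (be a')) * la p.1 p.2 = nu a'.
  apply: complexI; transitivity (qf (gram (margK psi)) (be a') (be a')).
    rewrite qf_margK sum_prod raddf_sum; apply: eq_bigr => j _ /=.
    by rewrite (sqnorm_ip_marginal _ (dr j)).
  by rewrite (qf_eigen _ _ obe dbe) eqxx mulr1.
have u1 j a : \sum_a' sqnorm (ip (r j a) (be a')) = 1.
  by apply: one1 => //; rewrite [LHS]or eqxx.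
have u1' (p : J * K) : \sum_a' sqnorm (ip (r p.1 p.2) (be a')) = 1 by [].
have [sup2 sum2] := sum_relative_entropy (fun p : J * K => la0 p.1 p.2) u1' nuE.
have trE j : complex.Re (\sum_b gram (blockK psi j) b b) = \sum_a la j a.
  by rewrite (trace_diagonal (or j) (dr j)).
have := @relative_entropy_monotone _ _ _ (fun p => ip (v p.1) (w p.2)) (fun p => l p.1)
  (fun p => mu p.2.1 p.2.2)
  (fun p : J * (K * K) => ip (r p.1 p.2.1) (be p.2.2)) (fun p => la p.1 p.2.1)
  (fun p => c p.1 * nu p.2.2).
have -> : \sum_p sqnorm (ip (v p.1) (w p.2)) * l p.1 * ln (mu p.2.1 p.2.2 / l p.1) =
    ln 2 * (\sum_i etaf (l i) - \sum_k \sum_q etaf (mu k q)).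
  by rewrite sum_prod sum1 [X in _ * (_ - X) = _]sum_prod.
(* The factor c j splits off as the sum of p_j ln c_j and leaves ln 2 (S(XB) - S(B)); terms of
   weight zero are set aside, as their logarithm may be a default value. *)
have -> : \sum_(p : J * (K * K)) sqnorm (ip (r p.1 p.2.1) (be p.2.2)) * la p.1 p.2.1 *
      ln (c p.1 * nu p.2.2 / la p.1 p.2.1) =
    ln 2 * (\sum_j \sum_a etaf (la j a) - \sum_a' etaf (nu a')) +
    \sum_j (\sum_a la j a) * ln (c j).
  rewrite -[X in _ = ln 2 * (X - _) + _](sum_prod (fun p => etaf (la p.1 p.2))) -sum2.
  rewrite !sum_prod -big_split; apply: eq_bigr => j _ /=.
  rewrite sum_prod mulr_suml -big_split; apply: eq_bigr => a _ /=.
  rewrite -[X in _ = _ + X * _]mul1r -(u1 j a) !mulr_suml -big_split.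
  apply: eq_bigr => a' _ /=.
  have [->|h] := eqVneq (sqnorm (ip (r j a) (be a')) * la j a) 0.
    by rewrite !mul0r addr0.
  have nu_gt0 : 0 < nu a' by apply: (sup2 (j, a)).
  have la_gt0 : 0 < la j a.
    by rewrite lt_def la0 andbT; apply: contraNneq h => ->; rewrite mulr0.
  have -> : ln (c j * nu a' / la j a) = ln (c j) + ln (nu a' / la j a).
    by rewrite -mulrA lnM ?posrE ?divr_gt0.
  rewrite mulrDr addrC; congr (_ + _); ring.
move=> H; suff : ln 2 * (\sum_i etaf (l i) - \sum_k \sum_q etaf (mu k q)) <=
    ln 2 * (\sum_j \sum_a etaf (la j a) - \sum_a' etaf (nu a')) +
    \sum_j (\sum_a la j a) * ln (c j).
  have -> : \sum_j complex.Re (\sum_b gram (blockK psi j) b b) * log2 (1 / c j) =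
      - (\sum_j (\sum_a la j a) * ln (c j)) / ln 2.
    rewrite mulNr mulr_suml -sumrN; apply: eq_bigr => j _.
    by rewrite trE /log2 div1r lnV ?posrE //; field; rewrite gt_eqF ?ln2_gt0.
  set X := \sum_j _ * _; set a := \sum_i _; set b := \sum_k _; set d := \sum_j _; set e := \sum_i _.
  have l2 := ln2_gt0.
  have -> : X = ln 2 * (X / ln 2) by field; rewrite gt_eqF.
  rewrite -mulrDr ler_pM2l // mulNr [_ * (X / _) / _]mulrAC divff ?gt_eqF // mul1r.
  lra.
apply: H => //.
- by move=> p; exact: sup1.
- by move=> p; rewrite mulr_ge0 // ltW.
- by move=> p h; rewrite mulr_gt0 //; apply: (sup2 (p.1, p.2.1)).
- transitivity (\sum_i l i).
    rewrite sum_prod; apply: eq_bigr => i _ /=; by rewrite -mulr_suml v1 mul1r.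
  transitivity (\sum_j \sum_a la j a).
    apply: complexI; rewrite -(trace_diagonal ov dv) raddf_sum !sum_prod.
    apply: eq_bigr => j _ /=; rewrite -(trace_diagonal (or j) (dr j)).
    by apply: eq_bigr => b _; rewrite /gram sum_prod.
  rewrite sum_prod; apply: eq_bigr => j _; rewrite sum_prod; apply: eq_bigr => a _ /=.
  by rewrite -mulr_suml u1 mul1r.
- move=> y'; exists (lift_coef z v s r be y'); split.
  + exact: lift_linear.
  + by rewrite le_eqVlt; apply/orP; left; apply/eqP; exact: lift_left.
  + exact: lift_right.
Qed.

End UncertaintyCore.

(** * Two measurements with quantum memories *)

Section Measurements.
Variable R : realType.
Local Notation C := (R[i]).
Local Notation "x %:C" := (real_complex R x).
Variable d : nat.
Implicit Types U V : 'M[C]_d.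

Lemma ortho_basis_complete U : ortho_basis U -> complete (fun j a => U a j).
Proof.
move=> oU.
have e : (\matrix_(i, j) conjc (U j i)) *m U = 1%:M.
  by apply/matrixP => i j; rewrite !mxE -oU; apply: eq_bigr => a _; rewrite mxE.
move=> a a'; have /matrixP /(_ a a') := mulmx1C e.
by rewrite !mxE => <-; apply: eq_bigr => j _; rewrite mxE.
Qed.

Definition measured U (K H : finType) (chi : 'I_d * K -> H -> C) (j : 'I_d) : K -> H -> C :=
  fun b h => \sum_a conjc (U a j) * chi (a, b) h.

(** A moves into the environment, so the Gram kernel is the partial trace over A; [traceK] does the
    same for K. *)
Definition traceA (K H : finType) (chi : 'I_d * K -> H -> C) : K -> 'I_d * H -> C :=
  fun b t => chi (t.1, b) t.2.

Definition traceK (K H : finType) (chi : 'I_d * K -> H -> C) : 'I_d -> K * H -> C :=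
  fun a t => chi (a, t.1) t.2.

Lemma eq_rhoMX U (K : finType) (s1 s2 : 'I_d * K -> 'I_d * K -> C) :
  s1 =2 s2 -> rhoMX U s1 =2 rhoMX U s2.
Proof.
move=> e x y; apply: eq_bigr => j _; apply: eq_bigr => a _; apply: eq_bigr => a' _.
by rewrite e.
Qed.

(** The measured state is the sum of |u_j><u_j| tensored with the conditional states, so its
    eigenvectors are u_j tensored with theirs. *)
Lemma vN_rhoMX U (K H : finType) (chi : 'I_d * K -> H -> C) : ortho_basis U ->
  vN (rhoMX U (gram chi)) = \sum_j vN (gram (measured U chi j)).
Proof.
move=> oU.
have [D DP] := fin_all_exists (fun j => let: ex_intro l (ex_intro V h) :=
  gram_diagonalization (measured U chi j) in ex_intro (fun p : _ * _ =>
    [/\ forall i, 0 <= p.1 i, ortho_family p.2, complete p.2,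
     diagonalizes (gram (measured U chi j)) p.1 p.2
     & vN (gram (measured U chi j)) = \sum_i etaf (p.1 i)]) (l, V) h).
transitivity (\sum_(p : 'I_d * K) etaf ((D p.1).1 p.2)); last first.
  by rewrite sum_prod; apply: eq_bigr => j _; have [_ _ _ _ ->] := DP j.
pose W (p : 'I_d * K) (x : 'I_d * K) := U x.1 p.1 * (D p.1).2 p.2 x.2.
rewrite -(vN_decomposition (V := W)).
  apply: eq_vN => x y; rewrite /rhoMX sum_prod; apply: eq_bigr => j _ /=.
  transitivity (U x.1 j * conjc (U y.1 j) * gram (measured U chi j) x.2 y.2).
    rewrite /gram [RHS]mulr_sumr.
    rewrite [RHS](eq_bigr (fun h => \sum_a \sum_a' U x.1 j * conjc (U y.1 j) *
       (conjc (U a j) * chi (a, x.2) h * conjc (conjc (U a' j) * chi (a', y.2) h)))); last first.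
      move=> h _; rewrite /measured conjc_sum big_distrlr mulr_sumr.
      by apply: eq_bigr => a _; rewrite mulr_sumr.
    rewrite [RHS]exchange_big; apply: eq_bigr => a _ /=.
    rewrite [RHS]exchange_big; apply: eq_bigr => a' _ /=.
    rewrite mulr_sumr mulr_suml; apply: eq_bigr => h _.
    by rewrite conjcM conjcK; ring.
  have [_ _ _ dj _] := DP j; rewrite dj mulr_sumr; apply: eq_bigr => q _.
  by rewrite /W /= conjcM; ring.
case=> j q [j' q']; rewrite sum_prod /W /=.
transitivity ((\sum_a conjc (U a j) * U a j') * \sum_b conjc ((D j).2 q b) * (D j').2 q' b).
  rewrite big_distrlr; apply: eq_bigr => a _; apply: eq_bigr => b _ /=.
  by rewrite conjcM; ring.
rewrite oU xpair_eqE; have [<-|] := eqVneq j j'; last by rewrite mul0r.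
by have [_ oD _ _ _] := DP j; rewrite mul1r oD.
Qed.

Lemma prob_qf U (rA : 'I_d -> 'I_d -> C) j :
  prob U rA j = complex.Re (qf rA (fun a => U a j) (fun a => U a j)).
Proof. by []. Qed.

Lemma trace_measured U (K H : finType) (chi : 'I_d * K -> H -> C) j :
  \sum_b gram (measured U chi j) b b =
  qf (gram (traceK chi)) (fun a => U a j) (fun a => U a j).
Proof.
rewrite qf_gram sum_prod; apply: eq_bigr => b _; apply: eq_bigr => h _.
by rewrite -[X in _ = _ * X]conj_ip.
Qed.

Section Rotation.
Variables (U V : 'M[C]_d).
Hypotheses (oU : ortho_basis U) (oV : ortho_basis V).
Variables (K F G : finType) (phi : 'I_d * K * F -> G -> C).

(** Of the pure vector phi on A K F G, [joinFG] keeps A K and [swapG] keeps A G; the remaining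
    factors are the environment. *)
Definition joinFG : 'I_d * K -> F * G -> C := fun x t => phi (x.1, x.2, t.1) t.2.

Definition swapG : 'I_d * G -> K * F -> C := fun x t => phi (x.1, t.1, t.2) x.2.

(** Expresses A in the basis U, since [entropic_uncertainty] takes X to be the computational basis;
    [overlap k] is the k-th vector of V in the same coordinates. *)
Definition rotated : 'I_d * K * F -> G -> C :=
  fun x g => \sum_a conjc (U a x.1.1) * phi (a, x.1.2, x.2) g.

Definition overlap k j := \sum_a conjc (U a j) * V a k.

Lemma complete_overlap : complete overlap.
Proof.
move=> j j'; transitivity (ip (fun a => U a j) (fun a => U a j')); last by rewrite [LHS]oU.
rewrite -(parseval _ _ (ortho_basis_complete oV)); apply: eq_bigr => k _.
by rewrite -[ip _ (fun a => U a j')]conj_ip.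
Qed.

(** Purity gives S(AKF) = S(G), and by Parseval the rotation of A does not affect the state on G. *)
Lemma vN_rotated : vN (gram rotated) = vN (gram (traceA swapG)).
Proof.
rewrite vN_gram_swap; apply: eq_vN => g g'.
rewrite /gram !sum_prod exchange_big [RHS]exchange_big [RHS]sum_prod.
apply: eq_bigr => b _ /=; rewrite exchange_big; apply: eq_bigr => f _ /=.
pose p g a := phi (a, b, f) g.
transitivity (\sum_j ip (p g') (fun a => U a j) * ip (fun a => U a j) (p g)).
  by apply: eq_bigr => j _; rewrite mulrC -[ip (p g') _]conj_ip.
rewrite (parseval _ _ (ortho_basis_complete oU)) /ip; apply: eq_bigr => a _.
by rewrite mulrC.
Qed.

Lemma blockKF_rotated k : blockKF rotated overlap k =2 (fun y g => measured V swapG k g y).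
Proof.
move=> [b f] g; rewrite /blockKF /measured /overlap /rotated /swapG /=.
pose p a := phi (a, b, f) g.
transitivity (\sum_j ip (fun a => V a k) (fun a => U a j) * ip (fun a => U a j) p).
  by apply: eq_bigr => j _; rewrite -conj_ip.
by rewrite (parseval _ _ (ortho_basis_complete oU)).
Qed.

Lemma gram_margK_rotated : gram (margK rotated) =2 gram (traceA joinFG).
Proof.
move=> b b'; rewrite /gram !sum_prod exchange_big [RHS]exchange_big; apply: eq_bigr => t _ /=.
pose p b a := phi (a, b, t.1) t.2.
transitivity (\sum_j ip (p b') (fun a => U a j) * ip (fun a => U a j) (p b)).
  by apply: eq_bigr => j _; rewrite mulrC -[ip (p b') _]conj_ip.
rewrite (parseval _ _ (ortho_basis_complete oU)) /ip; apply: eq_bigr => a _.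
by rewrite mulrC.
Qed.

Lemma cc_le_rowmax j k : cc U V j k <= rowmax U V j.
Proof. exact: (le_bigmax _ (fun l => cc U V j l)). Qed.

(** This is [entropic_uncertainty] for the rotated vector with B = K. Purity turns S(ABF) into S(G)
    and S(ZBF) into S(ZG), so G becomes the second memory. *)
Lemma measured_uncertainty :
  vN (gram (traceA joinFG)) + vN (gram (traceA swapG))
    + \sum_j prob U (gram (traceK joinFG)) j * log2 (1 / rowmax U V j)
  <= vN (rhoMX U (gram joinFG)) + vN (rhoMX V (gram swapG)).
Proof.
rewrite !vN_rhoMX // -vN_rotated -(eq_vN gram_margK_rotated).
rewrite [leRHS]addrC.
have <- : \sum_k vN (gram (blockKF rotated overlap k)) = \sum_k vN (gram (measured V swapG k)).
  apply: eq_bigr => k _; rewrite [RHS]vN_gram_swap; apply: eq_vN => x y.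
  by apply: eq_bigr => g _; rewrite !blockKF_rotated.
have -> : \sum_j prob U (gram (traceK joinFG)) j * log2 (1 / rowmax U V j) =
    \sum_j complex.Re (\sum_b gram (blockK rotated j) b b) * log2 (1 / rowmax U V j).
  by apply: eq_bigr => j _; rewrite prob_qf -trace_measured.
apply: (entropic_uncertainty rotated complete_overlap) => j k; exact: cc_le_rowmax.
Qed.

End Rotation.
End Measurements.

(** * The relations with two, one and no memories *)

Section PairwiseRelations.
Variable R : realType.
Local Notation C := (R[i]).
Local Notation "x %:C" := (real_complex R x).
Variable d : nat.
Implicit Types U V : 'M[C]_d.

Lemma sum_unit (M : nmodType) (f : unit -> M) : \sum_u f u = f tt.
Proof. by rewrite (bigD1 tt) //= big1 ?addr0 // => -[]. Qed.

Lemma eq_prob U (r1 r2 : 'I_d -> 'I_d -> C) j : r1 =2 r2 -> prob U r1 j = prob U r2 j.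
Proof. by move=> e; rewrite !prob_qf; congr (complex.Re _); apply: eq_qf. Qed.

Lemma cc_sym U V k l : cc U V k l = cc V U l k.
Proof.
rewrite /cc -[LHS]sqnorm_conj; congr sqnorm; rewrite conjc_sum.
by apply: eq_bigr => a _; rewrite conjcM conjcK mulrC.
Qed.

Lemma colmaxE U V l : colmax U V l = rowmax V U l.
Proof. by apply: eq_bigr => k _; rewrite cc_sym. Qed.

Definition bound U V (rA : 'I_d -> 'I_d -> C) :=
  \sum_j prob U rA j * log2 (1 / rowmax U V j).

Lemma q_stateE U V rA : q_state U V rA = Num.max (bound U V rA) (bound V U rA).
Proof. by congr Num.max; apply: eq_bigr => l _; rewrite colmaxE. Qed.

Lemma eq_bound U V r1 r2 : r1 =2 r2 -> bound U V r1 = bound U V r2.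
Proof. by move=> e; apply: eq_bigr => j _; rewrite (eq_prob U j e). Qed.

Lemma vN_unit (G : finType) (psi : unit -> G -> C) :
  vN (gram psi) = etaf (complex.Re (gram psi tt tt)).
Proof.
have o : ortho_family (fun _ _ : unit => 1 : C).
  by case=> -[]; rewrite sum_unit conjc1 mulr1 eqxx.
rewrite -(sum_unit (fun _ => etaf (complex.Re (gram psi tt tt)))).
rewrite -(vN_decomposition (fun _ => complex.Re (gram psi tt tt)) o).
apply: eq_vN => -[] []; rewrite sum_unit conjc1 !mulr1 RRe_real //.
by apply: ger0_real; apply: sumr_ge0 => g _; rewrite mulcJ_ge0.
Qed.

Lemma uncertainty_two_memories U V (K F G : finType) (phi : 'I_d * K * F -> G -> C) rA :
  ortho_basis U -> ortho_basis V -> rA =2 gram (traceK (joinFG phi)) ->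
  q_state U V rA + vN (gram (traceA (joinFG phi))) + vN (gram (traceA (swapG phi)))
  <= vN (rhoMX U (gram (joinFG phi))) + vN (rhoMX V (gram (swapG phi))).
Proof.
move=> oU oV eA; rewrite q_stateE -addrA -lerBrDr ge_max; apply/andP; split.
  rewrite lerBrDr [leLHS]addrC (eq_bound U V eA).
  exact: (measured_uncertainty oU oV phi).
(* Exchanging the memories K and G exchanges the roles of U and V, which yields the second term of
   the maximum. *)
pose phi' : 'I_d * G * F -> K -> C := fun x b => phi (x.1.1, b, x.2) x.1.2.
have e1 : gram (joinFG phi') =2 gram (swapG phi).
  by move=> x y; rewrite /gram !sum_prod exchange_big.
have e2 : gram (swapG phi') =2 gram (joinFG phi).
  by move=> x y; rewrite /gram !sum_prod exchange_big.
have e3 : gram (traceA (joinFG phi')) =2 gram (traceA (swapG phi)).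
  by move=> x y; rewrite /gram !sum_prod; apply: eq_bigr => a _; rewrite !sum_prod exchange_big.
have e4 : gram (traceA (swapG phi')) =2 gram (traceA (joinFG phi)).
  by move=> x y; rewrite /gram !sum_prod; apply: eq_bigr => a _; rewrite !sum_prod exchange_big.
have e5 : rA =2 gram (traceK (joinFG phi')).
  move=> a a'; rewrite eA /gram !sum_prod.
  under eq_bigr do rewrite sum_prod exchange_big /=.
  rewrite exchange_big; apply: eq_bigr => g _ /=.
  by rewrite exchange_big sum_prod.
have := measured_uncertainty oV oU phi'.
rewrite (eq_vN e3) (eq_vN e4) (eq_vN (eq_rhoMX V e1)) (eq_vN (eq_rhoMX U e2)).
rewrite -/(bound _ _ _) -(eq_bound V U e5) => h.
by rewrite lerBrDr [leLHS]addrC [X in X + _]addrC [leRHS]addrC.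
Qed.

(** Take F one-dimensional: then G purifies A K, so S(G) = S(AK), and the pure conditional vectors
    give S(ZG) = S(ZK). *)
Lemma measured_uncertainty_one_memory U V (K G : finType) (chi : 'I_d * K -> G -> C) :
  ortho_basis U -> ortho_basis V ->
  bound U V (gram (traceK chi)) + (vN (gram (traceA chi)) + vN (gram chi))
  <= vN (rhoMX U (gram chi)) + vN (rhoMX V (gram chi)).
Proof.
move=> oU oV.
pose phi : 'I_d * K * unit -> G -> C := fun x g => chi x.1 g.
have e1 : gram (joinFG phi) =2 gram chi.
  by case=> a b [a' b']; rewrite /gram sum_prod sum_unit.
have e2 : gram (traceA (joinFG phi)) =2 gram (traceA chi).
  by move=> b b'; rewrite /gram !sum_prod; apply: eq_bigr => a _; rewrite sum_prod sum_unit.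
have e3 : gram (traceK (joinFG phi)) =2 gram (traceK chi).
  by move=> b b'; rewrite /gram !sum_prod; apply: eq_bigr => a _; rewrite sum_prod sum_unit.
have e4 : vN (gram (traceA (swapG phi))) = vN (gram chi).
  rewrite [RHS]vN_gram_swap; apply: eq_vN => g g'; rewrite /gram !sum_prod.
  apply: eq_bigr => a _; rewrite sum_prod; apply: eq_bigr => b _.
  by rewrite sum_unit.
have e5 : vN (rhoMX V (gram (swapG phi))) = vN (rhoMX V (gram chi)).
  rewrite !vN_rhoMX //; apply: eq_bigr => k _; rewrite [RHS]vN_gram_swap.
  by apply: eq_vN => g g'; rewrite /gram sum_prod; apply: eq_bigr => b _; rewrite sum_unit.
have := measured_uncertainty oU oV phi.
rewrite (eq_vN e2) e4 e5 (eq_vN (eq_rhoMX U e1)) -/(bound _ _ _) (eq_bound U V e3).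
by rewrite [X in X <= _ -> _]addrC.
Qed.

Lemma uncertainty_one_memory U V (K G : finType) (chi : 'I_d * K -> G -> C) rA :
  ortho_basis U -> ortho_basis V -> rA =2 gram (traceK chi) ->
  q_state U V rA + vN (gram (traceA chi)) + vN (gram chi)
  <= vN (rhoMX U (gram chi)) + vN (rhoMX V (gram chi)).
Proof.
move=> oU oV eA; rewrite q_stateE -addrA -lerBrDr ge_max !(eq_bound _ _ eA) !lerBrDr.
apply/andP; split; first exact: measured_uncertainty_one_memory.
rewrite [leRHS]addrC; exact: measured_uncertainty_one_memory.
Qed.

(** A one-dimensional memory: its entropy is 0 by trace one, and the measured state has the entropy
    of the outcome distribution. *)
Lemma uncertainty_no_memory U V (G : finType) (chi : 'I_d -> G -> C) :
  ortho_basis U -> ortho_basis V -> \sum_a gram chi a a = 1 ->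
  q_state U V (gram chi) + vN (gram chi) <= shannonM U (gram chi) + shannonM V (gram chi).
Proof.
move=> oU oV tr.
pose chi' : 'I_d * unit -> G -> C := fun x g => chi x.1 g.
have eA : gram chi =2 gram (traceK chi').
  by move=> a a'; rewrite [RHS]/gram sum_prod sum_unit.
have eH W : ortho_basis W -> vN (rhoMX W (gram chi')) = shannonM W (gram chi).
  move=> oW; rewrite vN_rhoMX //; apply: eq_bigr => j _; rewrite vN_unit.
  rewrite -(sum_unit (fun u => gram (measured W chi' j) u u)) trace_measured -prob_qf.
  by rewrite -(eq_prob W j eA).
have -> : vN (gram chi) = vN (gram chi').
  rewrite vN_gram_swap [RHS]vN_gram_swap; apply: eq_vN => g g'.
  by rewrite [RHS]/gram sum_prod; apply: eq_bigr => a _; rewrite sum_unit.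
have e0 : vN (gram (traceA chi')) = 0.
  rewrite vN_unit; have -> : gram (traceA chi') tt tt = 1.
    by rewrite -tr /gram sum_prod.
  by rewrite /etaf /log2 /= ln1 mul0r mulr0 oppr0.
have := uncertainty_one_memory oU oV eA.
by rewrite e0 addr0 !eH.
Qed.

End PairwiseRelations.

(** * Reduced states *)

Section PartialTraces.
Variable R : realType.
Local Notation C := (R[i]).
Variables (d n : nat) (e : 'I_n -> nat).
Implicit Types (x y : Bidx e) (rho : Jidx d e -> Jidx d e -> C).

Definition upd (t : 'I_n) (b : 'I_(e t)) y : Bidx e := finfun (dfwith y b).

Lemma upd_in t (b : 'I_(e t)) y : upd b y t = b.
Proof. by rewrite ffunE dfwith_in. Qed.

Lemma upd_out t (b : 'I_(e t)) y s : s != t -> upd b y s = y s.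
Proof. by move=> st; rewrite ffunE dfwith_out // eq_sym. Qed.

Lemma upd_upd t (b b' : 'I_(e t)) y : upd b (upd b' y) = upd b y.
Proof.
apply/ffunP => s; have [->|st] := eqVneq s t; first by rewrite !upd_in.
by rewrite !upd_out.
Qed.

Lemma upd_id t y : upd (y t) y = y.
Proof.
apply/ffunP => s; have [->|st] := eqVneq s t; first by rewrite !upd_in.
by rewrite !upd_out.
Qed.

Lemma updC t s (b : 'I_(e t)) (c : 'I_(e s)) y :
  t != s -> upd b (upd c y) = upd c (upd b y).
Proof.
move=> ts; apply/ffunP => r.
have [->|rt] := eqVneq r t; first by rewrite upd_in upd_out // upd_in.
rewrite upd_out //; have [->|rs] := eqVneq r s; first by rewrite !upd_in.
by rewrite !upd_out.
Qed.

(** Labels of the subsystems other than t are represented by full labels frozen at one value of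
    coordinate t; [upd] carries any slice onto any other. *)
Lemma sum_slice t (b b0 : 'I_(e t)) (f : Bidx e -> C) :
  \sum_(y : Bidx e | y t == b) f y = \sum_(y : Bidx e | y t == b0) f (upd b y).
Proof.
rewrite (reindex_onto (fun y => upd b y) (fun y => upd b0 y)) /=; last first.
  by move=> y /eqP <-; rewrite upd_upd upd_id.
apply: eq_bigl => y; rewrite upd_in eqxx /=; apply/eqP/eqP => [<-|<-].
  by rewrite upd_upd upd_in.
by rewrite upd_upd upd_id.
Qed.

Lemma sum_slices t (b0 : 'I_(e t)) (P : pred (Bidx e)) (f : Bidx e -> C) :
  (forall (b : 'I_(e t)) y, P (upd b y) = P y) ->
  \sum_(y : Bidx e | P y) f y = \sum_(y : Bidx e | P y && (y t == b0)) \sum_(b : 'I_(e t)) f (upd b y).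
Proof.
move=> Pu; rewrite (partition_big (fun y : Bidx e => y t) xpredT) //= [RHS]exchange_big.
apply: eq_bigr => b _.
rewrite (eq_bigl (fun y => (y t == b) && P y)); last by move=> y; rewrite andbC.
rewrite big_mkcondr (sum_slice b b0) [RHS](eq_bigl (fun y => (y t == b0) && P y)).
  by rewrite [RHS]big_mkcondr; apply: eq_bigr => y _; rewrite Pu.
by move=> y; rewrite andbC.
Qed.

Lemma agreeE (t : 'I_n) x x' :
  [forall s, (s != t) ==> (x s == x' s)] = (x' == upd (x' t) x).
Proof.
apply/forallP/eqP => [h|->].
  apply/ffunP => s; have [->|st] := eqVneq s t; first by rewrite upd_in.
  by have := h s; rewrite st upd_out //= => /eqP ->.
by move=> s; apply/implyP => st; rewrite upd_out.
Qed.

Lemma sum_if_eq (T : finType) (t : T) (f : T -> C) (P : T -> bool) :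
  \sum_x (if (x == t) && P x then f x else 0) = if P t then f t else 0.
Proof.
rewrite (bigD1 t) //= eqxx /= [X in _ + X]big1 ?addr0 // => x /negPf ->.
by [].
Qed.

Lemma rhoAB_slice rho (t : 'I_n) (b0 b b' : 'I_(e t)) a a' :
  rhoAB rho t (a, b) (a', b') = \sum_(y : Bidx e | y t == b0) rho (a, upd b y) (a', upd b' y).
Proof.
transitivity (\sum_(y : Bidx e | y t == b) rho (a, y) (a', upd b' y)); last first.
  by rewrite (sum_slice b b0); apply: eq_bigr => y _; rewrite upd_upd.
rewrite /rhoAB sum_prod exchange_big [RHS]big_mkcond; apply: eq_bigr => y _ /=.
rewrite (eq_bigr (fun a1 => if (a1 == a) && (y t == b) then rho (a1, y) (a', upd b' y) else 0)).
  by rewrite sum_if_eq.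
move=> a1 _; rewrite sum_prod exchange_big /=.
case: eqP => [->|_] /=; last by rewrite big1 // => y' _; rewrite big1.
case: eqP => [_|yb] /=; last by rewrite big1 // => y' _; rewrite big1 // => a2 _; rewrite andbF.
rewrite (eq_bigr (fun y' => if (y' == upd b' y) && xpredT y' then rho (a, y) (a', y') else 0)).
  by rewrite sum_if_eq.
move=> y' _; rewrite (eq_bigr (fun a2 => if (a2 == a') && (y' == upd b' y)
    then rho (a, y) (a2, y') else 0)).
  by rewrite sum_if_eq andbT.
move=> a2 _; rewrite agreeE; congr (if _ && _ then _ else _).
apply/andP/eqP => [[/eqP <- /eqP //]|->].
by rewrite upd_in eqxx.
Qed.

Lemma rhoB_rhoAB rho (t : 'I_n) b b' :
  rhoB rho t b b' = \sum_a rhoAB rho t (a, b) (a, b').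
Proof.
rewrite /rhoB /rhoAB [RHS]exchange_big; apply: eq_bigr => x _ /=.
rewrite [RHS]exchange_big; apply: eq_bigr => x' _ /=.
rewrite (eq_bigr (fun a => if (a == x.1) && [&& x'.1 == a, x.2 t == b, x'.2 t == b' &
     [forall s, (s != t) ==> (x.2 s == x'.2 s)]] then rho x x' else 0)); last first.
  by move=> a _; rewrite [a == _]eq_sym.
rewrite sum_if_eq; congr (if _ then _ else _).
by rewrite [x.1 == _]eq_sym; do !bool_congr.
Qed.

Lemma rhoA_rhoAB rho (t : 'I_n) a a' :
  rhoA rho a a' = \sum_b rhoAB rho t (a, b) (a', b).
Proof.
rewrite /rhoA /rhoAB [RHS]exchange_big; apply: eq_bigr => x _ /=.
rewrite [RHS]exchange_big; apply: eq_bigr => x' _ /=.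
rewrite (eq_bigr (fun b => if (b == x.2 t) && [&& x.1 == a, x'.1 == a', x'.2 t == b &
     [forall s, (s != t) ==> (x.2 s == x'.2 s)]] then rho x x' else 0)); last first.
  move=> b _; congr (if _ then _ else _); rewrite [b == _]eq_sym.
  by do !bool_congr.
rewrite sum_if_eq; congr (if _ then _ else _); congr [&& _, _ & _].
rewrite agreeE; apply/eqP/andP => [->|[/eqP -> /eqP ->]]; first by rewrite upd_id !eqxx.
by rewrite upd_id.
Qed.

Section Purified.
Variables (H : finType) (psi : Jidx d e -> H -> C) (rho : Jidx d e -> Jidx d e -> C).
Hypothesis rhoE : rho =2 gram psi.
Variable x0 : Bidx e.

(* psi gives a purification of rho by H. The coordinate t of the environment label is frozen
   at x0 t, so that only the system B_t carries it. *)
Definition purify1 (t : 'I_n) : 'I_d * 'I_(e t) -> Bidx e * H -> C :=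
  fun p g => (g.1 t == x0 t)%:R * psi (p.1, upd p.2 g.1) g.2.

(** The memories are K = B_t and G = B_s, while F carries the other subsystems together with H; both
    coordinates of the label are frozen, so each configuration is counted once. *)
Definition purify2 (t s : 'I_n) : 'I_d * 'I_(e t) * (Bidx e * H) -> 'I_(e s) -> C :=
  fun p c => ((p.2.1 t == x0 t) && (p.2.1 s == x0 s))%:R *
             psi (p.1.1, upd c (upd p.1.2 p.2.1)) p.2.2.

Lemma rhoAB_purify1 t : rhoAB rho t =2 gram (purify1 (t := t)).
Proof.
case=> a b [a' b']; rewrite (rhoAB_slice _ (x0 t)) /gram sum_prod big_mkcond.
apply: eq_bigr => y _; rewrite rhoE /gram /purify1 /=; case: eqP => _.
  by apply: eq_bigr => h _; rewrite !mul1r.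
by rewrite big1 // => h _; rewrite !mul0r.
Qed.

Lemma rhoAB_joinFG t s : t != s -> rhoAB rho t =2 gram (joinFG (purify2 (t := t) (s := s))).
Proof.
move=> ts [a b] [a' b']; rewrite (rhoAB_slice _ (x0 t)).
rewrite (@sum_slices s (x0 s)); last by move=> c y; rewrite upd_out.
rewrite big_mkcond /gram !sum_prod; apply: eq_bigr => y _ /=.
rewrite /joinFG /purify2 /=; case: ifP => _; last first.
  by rewrite big1 // => h _; rewrite big1 // => c _; rewrite !mul0r.
rewrite exchange_big; apply: eq_bigr => c _ /=; rewrite rhoE.
by apply: eq_bigr => h _; rewrite !mul1r !(updC _ _ _ ts).
Qed.

Lemma rhoAB_swapG t s : t != s -> rhoAB rho s =2 gram (swapG (purify2 (t := t) (s := s))).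
Proof.
move=> ts [a c] [a' c']; rewrite (rhoAB_slice _ (x0 s)).
rewrite (@sum_slices t (x0 t)); last by move=> b y; rewrite upd_out // eq_sym.
rewrite big_mkcond /gram !sum_prod [RHS]exchange_big sum_prod; apply: eq_bigr => y _ /=.
rewrite /swapG /purify2 /= andbC; case: ifP => _; last first.
  by rewrite big1 // => h _; rewrite big1 // => b _; rewrite !mul0r.
rewrite exchange_big; apply: eq_bigr => b _ /=; rewrite rhoE.
by apply: eq_bigr => h _; rewrite !mul1r.
Qed.

Lemma rhoB_traceA t (G : finType) (chi : 'I_d * 'I_(e t) -> G -> C) :
  rhoAB rho t =2 gram chi -> rhoB rho t =2 gram (traceA chi).
Proof.
move=> E b b'; rewrite rhoB_rhoAB /gram sum_prod; apply: eq_bigr => a _.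
by rewrite E.
Qed.

Lemma rhoA_traceK t (G : finType) (chi : 'I_d * 'I_(e t) -> G -> C) :
  rhoAB rho t =2 gram chi -> rhoA rho =2 gram (traceK chi).
Proof.
move=> E a a'; rewrite (rhoA_rhoAB _ t) /gram sum_prod; apply: eq_bigr => b _.
by rewrite E.
Qed.

End Purified.
End PartialTraces.

(** * Comparison of the bounds *)

Section UncertaintyBounds.
Variable R : realType.
Local Notation C := (R[i]).
Local Notation "x %:C" := (real_complex R x).

Lemma log2_le (x y : R) : 0 < x -> x <= y -> log2 x <= log2 y.
Proof.
move=> x0 xy; rewrite /log2 ler_pM2r ?invr_gt0 ?ln2_gt0 // ler_ln ?posrE //.
exact: lt_le_trans xy.
Qed.

Lemma log2V (x : R) : 0 < x -> log2 (1 / x) = - log2 x.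
Proof. by move=> x0; rewrite /log2 div1r lnV ?posrE // mulNr. Qed.

Lemma log2_div (x y : R) : 0 < x -> 0 < y -> log2 (x / y) = log2 x - log2 y.
Proof. by move=> x0 y0; rewrite /log2 ln_div ?posrE // mulrBl. Qed.

Lemma qf_trace (T G I : finType) (chi : T -> G -> C) (V : I -> T -> C) :
  complete V -> \sum_i qf (gram chi) (V i) (V i) = \sum_x gram chi x x.
Proof.
move=> cV; under eq_bigr do rewrite qf_gram.
rewrite exchange_big [RHS]exchange_big; apply: eq_bigr => c _ /=.
under eq_bigr do rewrite mulrC.
by rewrite (parseval _ _ cV); apply: eq_bigr => x _; rewrite mulrC.
Qed.

Lemma qf_gram_sqnorm (T G : finType) (chi : T -> G -> C) f :
  qf (gram chi) f f = (\sum_c sqnorm (ip f (chi^~ c)))%:C.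
Proof.
by rewrite qf_gram rmorph_sum; apply: eq_bigr => c _; rewrite /= sqnorm_ip.
Qed.

Lemma Re_real (x : R) : complex.Re x%:C = x.
Proof. by []. Qed.

Lemma Re_realM (x : R) (y : C) : complex.Re (x%:C * y) = x * complex.Re y.
Proof. by case: y => a b /=; rewrite mul0r subr0. Qed.

(** The trace of A against the state is an average of the eigenvalues of A, with weights
    <V_i|rho|V_i> that sum to 1. *)
Lemma lambda_min_le d (A : 'M[C]_d) (G : finType) (chi : 'I_d -> G -> C) :
  (forall i j, A j i = conjc (A i j)) -> \sum_a gram chi a a = 1 ->
  lambda_min A <= complex.Re (\sum_a \sum_b A a b * gram chi b a).
Proof.
move=> hA tr; have [l [V [oV cV dV eV]]] := hermitian_mx_diagonalization hA.
have minl i : lambda_min A <= l i.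
  rewrite /lambda_min; set s := [seq _ | _ <- _].
  have : l i \in s.
    rewrite (perm_mem (perm_map _ eV)) -map_comp.
    by apply/mapP; exists i; rewrite ?mem_enum.
  by move=> si; exact: (@ge_bigmin_seq _ _ _ _ _ (l i) xpredT id).
have -> : \sum_a \sum_b A a b * gram chi b a = \sum_i (l i)%:C * qf (gram chi) (V i) (V i).
  rewrite exchange_big /qf; under [RHS]eq_bigr do rewrite mulr_sumr.
  rewrite [RHS]exchange_big; apply: eq_bigr => b _ /=.
  under [RHS]eq_bigr do rewrite mulr_sumr.
  rewrite [RHS]exchange_big; apply: eq_bigr => a _ /=.
  by rewrite dV mulr_suml; apply: eq_bigr => i _; ring.
rewrite Re_sum; under eq_bigr do rewrite Re_realM qf_gram_sqnorm Re_real.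
have p1 : \sum_i \sum_c sqnorm (ip (V i) (chi^~ c)) = 1.
  apply: complexI; rewrite rmorph1 -tr -(qf_trace _ cV) rmorph_sum.
  by apply: eq_bigr => i _; rewrite qf_gram_sqnorm.
rewrite -[lambda_min A]mulr1 -p1 mulr_sumr; apply: ler_sum => i _.
by rewrite ler_wpM2r // sumr_ge0 // => c _; exact: sqnorm_ge0.
Qed.

(* Expanding |f - x (<u|f> u + <v|f> v)|^2 >= 0 at x = 1 / (1 + |<u|v>|). *)
Lemma sqnorm_ip_two_unit_vectors (T : finType) (u v f : T -> C) (N : R) :
  ip u u = 1 -> ip v v = 1 -> ip f f = N%:C ->
  sqnorm (ip u f) + sqnorm (ip v f) <= (1 + Num.sqrt (sqnorm (ip u v))) * N.
Proof.
move=> u1 v1 fN.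
have expand (x : R) (al be : C) (h := fun t => f t - x%:C * (al * u t + be * v t)) :
    ip h h = ip f f - x%:C * (al * ip f u + be * ip f v)
     - x%:C * (conjc al * ip u f + conjc be * ip v f)
     + x%:C ^+ 2 * (conjc al * al * ip u u + conjc be * be * ip v v +
         conjc al * be * ip u v + conjc be * al * ip v u).
  rewrite /ip !mulr_sumr -!big_split !mulr_sumr -!sumrN -!big_split /=.
  apply: eq_bigr => t _; rewrite /h conjcB conjcM conjc_real conjcD !conjcM.
  by ring.
set al := ip u f; set be := ip v f; set ga := ip u v.
set S := sqnorm al + sqnorm be; set g := Num.sqrt _.
have g0 : 0 <= g by exact: sqrtr_ge0.
have gE : g ^+ 2 = sqnorm ga by rewrite sqr_sqrtr // sqnorm_ge0.
have S0 : 0 <= S by rewrite addr_ge0 ?sqnorm_ge0.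
pose re := complex.Re (conjc al * be * ga).
(* From re <= |al| |be| |ga| and 2 |al| |be| <= S, proved on squares. *)
have re_le : 2 * re <= S * g.
  have h : (2 * re) ^+ 2 <= (S * g) ^+ 2.
    rewrite exprMn [leRHS]exprMn gE.
    have h1 : re ^+ 2 <= sqnorm al * sqnorm be * sqnorm ga.
      rewrite -(sqnorm_conj al) -!sqnormM /sqnorm -/re.
      by rewrite lerDl sqr_ge0.
    apply: le_trans (_ : 2 ^+ 2 * (sqnorm al * sqnorm be * sqnorm ga) <= _).
      by rewrite ler_wpM2l // sqr_ge0.
    rewrite -subr_ge0 /S; have -> : (sqnorm al + sqnorm be) ^+ 2 * sqnorm ga -
      2 ^+ 2 * (sqnorm al * sqnorm be * sqnorm ga) =
      (sqnorm al - sqnorm be) ^+ 2 * sqnorm ga by ring.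
    by rewrite mulr_ge0 ?sqr_ge0 ?sqnorm_ge0.
  have Sg0 : 0 <= S * g by rewrite mulr_ge0.
  rewrite leNgt; apply/negP => lt; move: h; rewrite leNgt => /negP; apply.
  by rewrite ltr_pXn2r // ?nnegrE // ltW // (le_lt_trans Sg0).
pose x := (1 + g)^-1.
pose h t := f t - x%:C * (al * u t + be * v t).
have hh : ip h h = (N - 2 * x * S + x ^+ 2 * (S + 2 * re))%:C.
  have -> := expand x al be.
  rewrite u1 v1 fN -(conj_ip u f) -(conj_ip v f) -(conj_ip u v) -/al -/be -/ga /S /re /sqnorm.
  case: al {S S0 re re_le h} => a1 a2; case: be => b1 b2; case: (ga) => c1 c2.
  by simpc => /=; congr (_ +i* _)%C; ring.
have : 0 <= ip h h.
  by apply: sumr_ge0 => t _; rewrite mulrC mulcJ_ge0.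
rewrite hh ler0c => pos.
have g1 : 0 < 1 + g by lra.
have xg : x * (1 + g) = 1 by rewrite /x mulVf // gt_eqF.
have x0 : 0 < x by rewrite invr_gt0.
(* As [x * (1 + g) = 1], the quadratic term is at most x S, half of the linear term. *)
have : x * S <= N.
  have : x ^+ 2 * (S + 2 * re) <= x * S.
    have -> : x * S = x ^+ 2 * (S + S * g) by rewrite -{1}[x]mulr1 -xg; ring.
    by rewrite ler_wpM2l ?sqr_ge0 // lerD2l.
  lra.
by rewrite -(ler_pM2l g1) mulrA [(1 + g) * x]mulrC xg mul1r.
Qed.

Variable d : nat.
Variables (U V : 'M[C]_d).
Hypotheses (oU : ortho_basis U) (oV : ortho_basis V).
Variables (G : finType) (chi : 'I_d -> G -> C).
Hypothesis tr : \sum_a gram chi a a = 1.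
Local Notation rA := (gram chi).

Lemma prob_sqnorm W j : prob W rA j = \sum_c sqnorm (ip (fun a => W a j) (chi^~ c)).
Proof. by rewrite prob_qf qf_gram_sqnorm Re_real. Qed.

Lemma prob_ge0 W j : 0 <= prob W rA j.
Proof. by rewrite prob_sqnorm sumr_ge0 // => c _; exact: sqnorm_ge0. Qed.

Lemma sum_prob W : ortho_basis W -> \sum_j prob W rA j = 1.
Proof.
move=> oW; apply: complexI; rewrite rmorph1 -tr -(qf_trace _ (ortho_basis_complete oW)).
by rewrite rmorph_sum; apply: eq_bigr => j _; rewrite prob_sqnorm qf_gram_sqnorm.
Qed.

Lemma expectation_diagonal (W : 'M[C]_d) (r : 'I_d -> R) :
  complex.Re (\sum_a \sum_b (\sum_k (r k)%:C * W a k * conjc (W b k)) * rA b a) =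
  \sum_k prob W rA k * r k.
Proof.
transitivity (complex.Re (\sum_k (r k)%:C * qf rA (fun a => W a k) (fun a => W a k))).
  congr complex.Re; rewrite exchange_big /qf; under [RHS]eq_bigr do rewrite mulr_sumr.
  rewrite [RHS]exchange_big; apply: eq_bigr => b _ /=.
  under [RHS]eq_bigr do rewrite mulr_sumr.
  rewrite [RHS]exchange_big; apply: eq_bigr => a _ /=.
  by rewrite mulr_suml; apply: eq_bigr => k _; ring.
by rewrite Re_sum; apply: eq_bigr => k _; rewrite Re_realM mulrC.
Qed.

(** The smallest eigenvalue is at most the expectation in rho_A, a convex combination of the two
    sums whose maximum is [q_state]. *)
Lemma q_opt_le_state : q_opt U V <= q_state U V rA.
Proof.
apply: ge_sup; first by eexists; exists 0; split; [rewrite lexx ler01|reflexivity].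
move=> x [p [/andP [p0 p1] ->]].
set A := _ + _.
have hA i j : A j i = conjc (A i j).
  rewrite !mxE conjcD !conjcM !conjc_real !conjc_sum.
  by congr (_ * _ + _ * _); apply: eq_bigr => k _; rewrite !conjcM conjcK conjc_real; ring.
apply: le_trans (lambda_min_le hA tr) _.
have -> : complex.Re (\sum_a \sum_b A a b * rA b a) =
    p * \sum_k prob U rA k * log2 (1 / rowmax U V k) +
    (1 - p) * \sum_l prob V rA l * log2 (1 / colmax U V l).
  rewrite -!expectation_diagonal -!Re_realM.
  have ReD (y w : C) : complex.Re y + complex.Re w = complex.Re (y + w).
    by case: y => ? ?; case: w.
  rewrite ReD; congr complex.Re; rewrite !mulr_sumr -big_split; apply: eq_bigr => a _ /=.
  rewrite !mulr_sumr -big_split; apply: eq_bigr => b _ /=.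
  by rewrite !mxE; ring.
rewrite /q_state; set a := \sum_k _; set b := \sum_l _.
have ha : a <= Num.max a b by rewrite le_max lexx.
have hb : b <= Num.max a b by rewrite le_max lexx orbT.
rewrite [leRHS](_ : _ = p * Num.max a b + (1 - p) * Num.max a b); last by ring.
by rewrite lerD // ler_wpM2l // subr_ge0.
Qed.

Lemma rowmax_gt0 (W W' : 'M[C]_d) k : ortho_basis W -> ortho_basis W' -> 0 < rowmax W W' k.
Proof.
move=> oW oW'; rewrite ltNge; apply/negP => le0.
have : (\sum_l sqnorm (ip (fun a => W' a l) (fun a => W a k)))%:C = 1.
  rewrite (sum_sqnorm_ip _ (ortho_basis_complete oW')).
  by rewrite [LHS]oW eqxx.
rewrite big1 => [/eqP|l _]; first by rewrite eq_sym oner_eq0.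
apply/eqP; rewrite eq_le sqnorm_ge0 andbT.
rewrite -(sqnorm_conj (ip _ _)) conj_ip; exact: le_trans (cc_le_rowmax W W' k l) le0.
Qed.

(** In a decreasing list at most one position lies strictly above the entry of index 1, while kl and
    kl' would give two. *)
Lemma c2_ge kl kl' : kl != kl' -> c2 U V < cc U V kl.1 kl.2 -> cc U V kl'.1 kl'.2 <= c2 U V.
Proof.
move=> ne h1; rewrite leNgt; apply/negP => h2.
pose f (kl : 'I_d * 'I_d) := cc U V kl.1 kl.2.
set c := c2 U V in h1 h2.
pose s := sort (fun x y : R => y <= x) [seq f kl | kl : ('I_d * 'I_d)%type].
have cE : c = nth 0 s 1 by [].
have so : sorted (fun x y : R => y <= x) s by apply: sort_sorted => x y; exact: le_total.
have : (count (fun x : R => (c < x)%R) s <= 1)%N.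
  case: s so cE => [|x t] //= p_t ct.
  rewrite (_ : count _ t = 0%N) ?addn0 ?leq_b1 //.
  apply/eqP; rewrite -leqn0 leqNgt -has_count; apply/hasPn => y yt.
  rewrite -leNgt ct; case: t p_t yt {ct} => [|x1 t] //= /andP [_ p_t].
  rewrite inE => /orP [/eqP -> //|yt].
  have tr' : transitive (fun x y : R => y <= x) by move=> a b e ab be_; exact: le_trans be_ ab.
  by have /allP /(_ _ yt) := order_path_min tr' p_t.
apply/negP; rewrite -ltnNge count_sort count_map -size_filter.
apply: leq_trans (_ : size [:: kl; kl'] <= _)%N; first by [].
apply: uniq_leq_size; first by rewrite /= inE ne.
move=> x; rewrite !inE mem_filter mem_enum andbT /= => /orP [] /eqP -> //.
Qed.

(** The probabilities sum to 1, so [bound] is an average over the rows; only row k0 may fall below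
    c0, by at most D. *)
Lemma bound_ge (c0 D : R) (W W' : 'M[C]_d) k0 : ortho_basis W -> ortho_basis W' ->
  (forall k, k != k0 -> c0 <= - log2 (rowmax W W' k)) ->
  c0 - D <= - log2 (rowmax W W' k0) ->
  c0 - prob W rA k0 * D <= bound W W' rA.
Proof.
move=> oW oW' h1 h2.
have -> : c0 - prob W rA k0 * D = \sum_k prob W rA k * (c0 - (k == k0)%:R * D).
  under eq_bigr do rewrite mulrBr.
  rewrite sumrB -mulr_suml (sum_prob oW) mul1r; congr (_ - _).
  rewrite (bigD1 k0) //= eqxx mul1r big1 ?addr0 // => k /negPf ->.
  by rewrite mul0r mulr0.
apply: ler_sum => k _; rewrite log2V ?rowmax_gt0 // ler_wpM2l ?prob_ge0 //.
have [->|ne] := eqVneq k k0; first by rewrite mul1r.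
by rewrite mul0r subr0 h1.
Qed.

Lemma rowmax_le_cmax k : rowmax U V k <= cmax U V.
Proof.
apply/bigmax_leP; split; first by exact: bigmax_ge_id.
by move=> l _; exact: (le_bigmax _ (fun kl => cc U V kl.1 kl.2) (k, l)).
Qed.

(** Let cmax be attained at (k0, l0) and D = log2 (cmax / c2). The two sums in [q_state] are at
    least - log2 c2 - p D and - log2 c2 - p' D for the probabilities p, p' of k0, l0. Averaging them
    with p + p' <= 1 + sqrt cmax gives the claim. *)
Lemma q_tilde_le_state : q_tilde U V <= q_state U V rA.
Proof.
have [k1 _] : exists k1 : 'I_d, true.
  case: (d) chi tr => [|d'] chi' tr'; last by exists ord0.
  by move/eqP: tr'; rewrite big_ord0 eq_sym oner_eq0.
have cm0 : 0 < cmax U V by apply: lt_le_trans (rowmax_le_cmax k1); exact: rowmax_gt0.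
have [[k0 l0] _ /= cmE] : {kl | kl \in predT & cmax U V = cc U V kl.1 kl.2}.
  by apply: (eq_bigmax (k1, k1)) => // kl _; exact: sqnorm_ge0.
rewrite q_stateE; set B := Num.max _ _.
have B1 : bound U V rA <= B by rewrite le_max lexx.
have B2 : bound V U rA <= B by rewrite le_max lexx orbT.
have lemax k : - log2 (cmax U V) <= - log2 (rowmax U V k).
  by rewrite lerN2 log2_le ?rowmax_gt0 ?rowmax_le_cmax.
rewrite /q_tilde /qMU.
(* For c2 <= 0 the quotient is at most 0, where [ln] is 0 by convention, so the correction to q_MU
   vanishes. *)
have [c20|c20] := ltP 0 (c2 U V); last first.
  rewrite [X in _ * X](_ : log2 _ = 0) ?mulr0 ?addr0; last first.
    rewrite /log2 ln0 ?mul0r // mulr_ge0_le0 ?invr_le0 // ltW //.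
  apply: le_trans B1; have := @bound_ge (- log2 (cmax U V)) 0 U V k1 oU oV (fun k _ => lemax k).
  by rewrite subr0 mulr0 subr0; apply.
have c2_le : c2 U V <= cmax U V.
  have : c2 U V \in [seq cc U V kl.1 kl.2 | kl : ('I_d * 'I_d)%type].
    rewrite -(mem_sort (fun x y : R => y <= x)) /c2 mem_nth //.
    by rewrite ltnNge; apply/negP => sz; move: c20; rewrite /c2 nth_default // ltxx.
  by case/mapP => kl _ ->; exact: (le_bigmax _ (fun kl => cc U V kl.1 kl.2)).
(* If c2 = cmax this holds for every entry; otherwise only the entry (k0, l0) exceeds c2. *)
have other kl : kl != (k0, l0) -> cc U V kl.1 kl.2 <= c2 U V.
  move=> ne; have [lt|le] := ltP (c2 U V) (cmax U V).
    by apply: (@c2_ge (k0, l0)); rewrite /= -?cmE // eq_sym.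
  by apply: le_trans le; exact: (le_bigmax _ (fun kl => cc U V kl.1 kl.2)).
rewrite log2_div //; set D := log2 (cmax U V) - log2 (c2 U V).
have D0 : 0 <= D by rewrite subr_ge0 log2_le.
have b1 : - log2 (c2 U V) - prob U rA k0 * D <= B.
  apply: le_trans B1; apply: bound_ge => //.
    move=> k kk; rewrite lerN2 log2_le ?rowmax_gt0 //.
    apply/bigmax_leP; split; first exact: ltW.
    by move=> l _; apply: (other (k, l)); rewrite xpair_eqE (negPf kk).
  by apply: le_trans (lemax k0); rewrite /D; lra.
have b2 : - log2 (c2 U V) - prob V rA l0 * D <= B.
  apply: le_trans B2; apply: bound_ge => //.
    move=> l ll; rewrite lerN2 log2_le ?rowmax_gt0 //.
    apply/bigmax_leP; split; first exact: ltW.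
    by move=> k _; rewrite -cc_sym; apply: (other (k, l)); rewrite xpair_eqE (negPf ll) andbF.
  apply: le_trans (_ : - log2 (cmax U V) <= _); first by rewrite /D; lra.
  rewrite lerN2 log2_le ?rowmax_gt0 //; apply/bigmax_leP; split; first exact: ltW.
  by move=> k _; rewrite -cc_sym; exact: (le_bigmax _ (fun kl => cc U V kl.1 kl.2) (k, l0)).
have pp : prob U rA k0 + prob V rA l0 <= 1 + Num.sqrt (cmax U V).
  rewrite !prob_sqnorm -big_split /=.
  pose N c := complex.Re (ip (chi^~ c) (chi^~ c)).
  have NE c : ip (chi^~ c) (chi^~ c) = (N c)%:C.
    rewrite /N RRe_real //; apply: ger0_real; apply: sumr_ge0 => a _.
    by rewrite mulrC mulcJ_ge0.
  have N1 : \sum_c N c = 1.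
    apply: complexI; rewrite rmorph1 -tr rmorph_sum /= exchange_big.
    by apply: eq_bigr => c _; rewrite -NE; apply: eq_bigr => a _; rewrite mulrC.
  rewrite -[leRHS]mulr1 -[X in _ <= _ * X]N1 mulr_sumr; apply: ler_sum => c _.
  rewrite cmE; apply: sqnorm_ip_two_unit_vectors => //.
    by rewrite [LHS]oU eqxx.
  by rewrite [LHS]oV eqxx.
have : (prob U rA k0 + prob V rA l0) * D <= (1 + Num.sqrt (cmax U V)) * D.
  by rewrite ler_wpM2r.
have DE : log2 (cmax U V) = log2 (c2 U V) + D by rewrite /D; ring.
rewrite DE; clearbody D; set s := Num.sqrt _; set p := prob U _ _; set p' := prob V _ _.
move: b1 b2; rewrite -/p -/p'; nra.
Qed.

Lemma Qval_le_state sel : Qval sel U V rA <= q_state U V rA.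
Proof. by case: sel => //=; [exact: q_tilde_le_state|exact: q_opt_le_state]. Qed.

End UncertaintyBounds.

(** * The three relations for a pair of measurements on the given state *)

Section Pairs.
Variable R : realType.
Local Notation C := (R[i]).
Variables (d n : nat) (e : 'I_n -> nat) (rho : Jidx d e -> Jidx d e -> C).
Hypothesis rho_state : is_state rho.

Lemma sum_pairs_lt (m : nat) (g : 'I_m -> 'I_m -> R) :
  (forall i j, g i j = g j i) ->
  \sum_(i < m) \sum_(j < m | (i < j)%N) g i j =
  (\sum_(i < m) \sum_(j < m) g i j - \sum_(i < m) g i i) / 2.
Proof.
move=> gC; set s := LHS.
have sE : s = \sum_(i < m) \sum_(j < m | (j < i)%N) g i j.
  rewrite /s (exchange_big_dep xpredT) //=; apply: eq_bigr => i _.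
  by apply: eq_bigr => j _; rewrite gC.
have -> : \sum_(i < m) \sum_(j < m) g i j = s + s + \sum_i g i i.
  rewrite {2}sE -!big_split; apply: eq_bigr => i _ /=.
  rewrite (bigID (fun j : 'I_m => (i < j)%N)) /= -addrA; congr (_ + _).
  rewrite (bigD1 i) ?ltnn //= addrC; congr (_ + _); apply: eq_bigl => j.
  by rewrite -leqNgt ltn_neqAle andbC.
by field.
Qed.

Lemma natr_mul_pred (k : nat) : (k * (k - 1))%:R = k%:R * (k%:R - 1) :> R.
Proof. by case: k => [|k]; rewrite ?mul0r // natrM natrB. Qed.

Lemma eq_q_state (U V : 'M[C]_d) r1 r2 : r1 =2 r2 -> q_state U V r1 = q_state U V r2.
Proof. by move=> E; rewrite !q_stateE !(eq_bound _ _ E). Qed.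

Lemma eq_Qval sel (U V : 'M[C]_d) r1 r2 : r1 =2 r2 -> Qval sel U V r1 = Qval sel U V r2.
Proof. by move=> E; case: sel => //=; exact: eq_q_state. Qed.

Lemma state_gram : exists psi : Jidx d e -> Jidx d e -> C, rho =2 gram psi.
Proof.
case: rho_state => h p _; exact: psd_gram.
Qed.

Lemma state_inhabited : exists x : Bidx e, true.
Proof.
case: rho_state => _ _ tr; case: (pickP (@predT (Jidx d e))) => [[a x] _|none].
  by exists x.
by move/eqP: tr; rewrite big_pred0 // eq_sym oner_eq0.
Qed.

Lemma trace_rhoA : \sum_a rhoA rho a a = 1.
Proof.
case: rho_state => _ _ <-; rewrite sum_prod; apply: eq_bigr => a _.
rewrite /rhoA sum_prod (bigD1 a) //= [X in _ + X]big1 ?addr0; last first.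
  move=> a1 a1a; rewrite big1 // => y _; rewrite big1 // => x _.
  by rewrite (negPf a1a).
apply: eq_bigr => y _; rewrite (bigD1 (a, y)) //= !eqxx /= big1 ?addr0 // => -[a1 y1].
rewrite xpair_eqE /=; case: eqP => //= _; case: eqP => [->|ne _]; first by rewrite eqxx.
by rewrite eq_sym; case: eqP ne.
Qed.

Lemma Qval_gram_le (G : finType) (chi : 'I_d -> G -> C) (U V : 'M[C]_d) sel :
  ortho_basis U -> ortho_basis V -> rhoA rho =2 gram chi ->
  Qval sel U V (rhoA rho) <= q_state U V (rhoA rho).
Proof.
move=> oU oV E; rewrite (eq_Qval _ _ _ E) (eq_q_state _ _ E).
apply: Qval_le_state => //; rewrite -trace_rhoA.
by apply: eq_bigr => a _; rewrite E.
Qed.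

Lemma same_memory_pair (t : 'I_n) (U V : 'M[C]_d) sel :
  ortho_basis U -> ortho_basis V ->
  Qval sel U V (rhoA rho) + condEnt (rhoAB rho t) (rhoB rho t)
  <= condEntM U (rhoAB rho t) (rhoB rho t) + condEntM V (rhoAB rho t) (rhoB rho t).
Proof.
move=> oU oV; have [psi E] := state_gram; have [x0 _] := state_inhabited.
have E1 := rhoAB_purify1 E x0 (t := t).
have EB := rhoB_traceA E1; have EA := rhoA_traceK E1.
have := uncertainty_one_memory oU oV EA; have := Qval_gram_le sel oU oV EA.
rewrite -(eq_vN EB) -(eq_vN E1) -(eq_vN (eq_rhoMX U E1)) -(eq_vN (eq_rhoMX V E1)).
rewrite /condEnt /condEntM; lra.
Qed.

Lemma distinct_memories_pair (t s : 'I_n) (U V : 'M[C]_d) sel : t != s ->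
  ortho_basis U -> ortho_basis V ->
  Qval sel U V (rhoA rho)
  <= condEntM U (rhoAB rho t) (rhoB rho t) + condEntM V (rhoAB rho s) (rhoB rho s).
Proof.
move=> ts oU oV; have [psi E] := state_gram; have [x0 _] := state_inhabited.
have Et := rhoAB_joinFG E x0 ts; have Es := rhoAB_swapG E x0 ts.
have EBt := rhoB_traceA Et; have EBs := rhoB_traceA Es; have EA := rhoA_traceK Et.
have := uncertainty_two_memories oU oV EA; have := Qval_gram_le sel oU oV EA.
rewrite -(eq_vN EBt) -(eq_vN EBs) -(eq_vN (eq_rhoMX U Et)) -(eq_vN (eq_rhoMX V Es)).
rewrite /condEntM; lra.
Qed.

(** The index t supplies a purification of rho_AB_t, from which rho_A is obtained as a Gram
    kernel. *)
Lemma no_memory_pair (t : 'I_n) (U V : 'M[C]_d) sel :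
  ortho_basis U -> ortho_basis V ->
  Qval sel U V (rhoA rho) + vN (rhoA rho)
  <= shannonM U (rhoA rho) + shannonM V (rhoA rho).
Proof.
move=> oU oV; have [psi E] := state_gram; have [x0 _] := state_inhabited.
have EA := rhoA_traceK (rhoAB_purify1 E x0 (t := t)).
have eqS W : shannonM W (rhoA rho) = shannonM W (gram (traceK (purify1 psi x0 (t := t)))).
  by apply: eq_bigr => j _; rewrite (eq_prob W j EA).
have tr : \sum_a gram (traceK (purify1 psi x0 (t := t))) a a = 1.
  by rewrite -trace_rhoA; apply: eq_bigr => a _; rewrite EA.
have := uncertainty_no_memory oU oV tr; have := Qval_gram_le sel oU oV EA.
rewrite -(eq_vN EA) -(eq_q_state _ _ EA) -!eqS; lra.
Qed.

End Pairs.

(** * Summation over the pairs of measurements *)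

Theorem theorem2 (R : realType) (d m n : nat) (e : 'I_n -> nat)
  (rho : Jidx d e -> Jidx d e -> R[i])
  (U : 'I_m -> 'M[R[i]]_d)
  (S : 'I_n -> {set 'I_m})
  (sel : 'I_m -> 'I_m -> Qkind) :
  (2 <= m)%N -> (1 <= n <= m)%N ->
  is_state rho ->
  (forall i, ortho_basis (U i)) ->
  (forall t, S t != set0) ->
  (forall t s, t != s -> [disjoint S t & S s]) ->
  \bigcup_(t < n) S t = [set: 'I_m] ->
  let mt t := #|S t| in
  let delta :=
    ((m * (m - 1))%:R - (\sum_(t < n) mt t * (mt t - 1))%:R) / (2 * (m - 1))%:R
        * vN (rhoA rho)
    + \sum_(t < n) (mt t * (mt t - 1))%:R / (2 * (m - 1))%:R
        * mutInf (rhoA rho) (rhoB rho t) (rhoAB rho t)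
    - \sum_(t < n) \sum_(i in S t) holevo (U i) (rhoA rho) (rhoAB rho t) (rhoB rho t)
  in
  \sum_(t < n) \sum_(i in S t) condEntM (U i) (rhoAB rho t) (rhoB rho t)
  >= (m - 1)%:R^-1 * \sum_(i < m) \sum_(j < m | (i < j)%N) Qval (sel i j) (U i) (U j) (rhoA rho)
     + (m - 1)%:R^-1 * \sum_(t < n) (mt t * (mt t - 1))%:R / 2
        * condEnt (rhoAB rho t) (rhoB rho t)
     + Num.max 0 delta.
Proof.
move=> m2 /andP [n1 _] st oU _ dis cov.
lazy beta zeta; set delta := (X in Num.max 0 X).
(* The sets S t partition the measurements: tau i is the index of the memory that goes with
   measurement i. *)
have [tau tauP] : exists tau : 'I_m -> 'I_n, forall i, i \in S (tau i).
  apply: (fin_all_exists (P := fun i t => i \in S t)) => i; have : i \in \bigcup_(t < n) S t by rewrite cov inE.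
  by case/bigcupP => t _ it; exists t.
have inS i t : (i \in S t) = (t == tau i).
  apply/idP/eqP => [it|->]; last exact: tauP.
  apply/eqP/negPn/negP => ne; have /pred0P /(_ i) := dis _ _ ne.
  by rewrite /= it tauP.
have sumS (F : 'I_n -> 'I_m -> R) :
    \sum_(t < n) \sum_(i in S t) F t i = \sum_(i < m) F (tau i) i.
  rewrite (exchange_big_dep xpredT) //=; apply: eq_bigr => i _.
  by rewrite (eq_bigl (pred1 (tau i))) ?big_pred1_eq // => t; rewrite inS.
have sum_tau (F : 'I_n -> R) : \sum_(i < m) F (tau i) = \sum_(t < n) (#|S t|)%:R * F t.
  rewrite -(sumS (fun t _ => F t)); apply: eq_bigr => t _.
  by rewrite sumr_const mulr_natl.
pose E t := condEnt (rhoAB rho t) (rhoB rho t).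
pose h i := condEntM (U i) (rhoAB rho (tau i)) (rhoB rho (tau i)).
pose sh i := shannonM (U i) (rhoA rho).
pose ho i := holevo (U i) (rhoA rho) (rhoAB rho (tau i)) (rhoB rho (tau i)).
have hE i : h i = sh i - ho i by rewrite /h /sh /ho /condEntM /holevo; ring.
set Q := \sum_(i < m) _.
pose vA := vN (rhoA rho).
pose KE := \sum_(t < n) (#|S t| * (#|S t| - 1))%:R * E t.
have m1 : (0 : R) < m%:R - 1 by rewrite subr_gt0 ltr1n.
have m1E : (m - 1)%:R = m%:R - 1 :> R by rewrite natrB // ltnW.
(* Each index lies in m - 1 of the pairs i < j. *)
have pair_sum (a : 'I_m -> R) :
    \sum_(i < m) \sum_(j < m | (i < j)%N) (a i + a j) = (m%:R - 1) * \sum_i a i.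
  rewrite sum_pairs_lt; last by move=> i j; rewrite addrC.
  have -> : \sum_(i < m) \sum_(j < m) (a i + a j) = 2 * (m%:R * \sum_i a i).
    under eq_bigr do rewrite big_split /= sumr_const card_ord -mulr_natl.
    rewrite big_split /= -mulr_sumr sumr_const card_ord -mulr_natl; ring.
  by rewrite big_split /=; field.
(* S(A|B_t) arises once for each of the m_t (m_t - 1) / 2 pairs that share the memory t. *)
have ineq1 : Q + KE / 2 <= (m%:R - 1) * \sum_i h i.
  have -> : KE / 2 = \sum_(i < m) \sum_(j < m | (i < j)%N) (tau i == tau j)%:R * E (tau i).
    rewrite sum_pairs_lt; last first.
      by move=> i j; rewrite [tau j == _]eq_sym; case: eqP => [->//|]; rewrite !mul0r.
    congr (_ / _); rewrite (eq_bigr (fun i => (#|S (tau i)|)%:R * E (tau i))); last first.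
      move=> i _; rewrite -mulr_suml; congr (_ * _).
      have := sum_tau (fun t => (tau i == t)%:R); move=> /= ->.
      rewrite (bigD1 (tau i)) //= eqxx mulr1 big1 ?addr0 // => t.
      by rewrite eq_sym => /negPf ->; rewrite mulr0.
    rewrite (sum_tau (fun t => (#|S t|)%:R * E t)).
    rewrite (eq_bigr (fun i => E (tau i))); last by move=> i _; rewrite eqxx mul1r.
    rewrite sum_tau -sumrB /KE; apply: eq_bigr => t _.
    by rewrite natr_mul_pred; ring.
  rewrite -(pair_sum h) /Q -big_split; apply: ler_sum => i _; rewrite -big_split /=.
  apply: ler_sum => j ij; case: eqP => [tij|/eqP tij].
    by rewrite mul1r /h -tij; exact: same_memory_pair.
  by rewrite mul0r addr0; exact: distinct_memories_pair.
(* The relation without memory, in which every pair contributes S(A). *)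
have ineq2 : Q + m%:R * (m%:R - 1) / 2 * vA <= (m%:R - 1) * \sum_i sh i.
  have -> : m%:R * (m%:R - 1) / 2 * vA = \sum_(i < m) \sum_(j < m | (i < j)%N) vA.
    have := pair_sum (fun _ => vA / 2); rewrite /= -splitr sumr_const card_ord -mulr_natl.
    by move=> ->; field.
  rewrite -(pair_sum sh) /Q -big_split; apply: ler_sum => i _; rewrite -big_split /=.
  by apply: ler_sum => j ij; exact: (no_memory_pair st (Ordinal n1)).
(* With I(A:B_t) = S(A) - S(A|B_t), the coefficients of S(A) add up to m / 2. *)
have deltaE : delta = m%:R / 2 * vA - KE / (2 * (m%:R - 1)) - \sum_i ho i.
  rewrite /delta sumS -/ho; congr (_ - _).
  have -> : \sum_(t < n) (#|S t| * (#|S t| - 1))%:R / (2 * (m - 1))%:R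
      * mutInf (rhoA rho) (rhoB rho t) (rhoAB rho t) =
      (\sum_(t < n) (#|S t| * (#|S t| - 1))%:R * (vA - E t)) / (2 * (m - 1))%:R.
    rewrite mulr_suml; apply: eq_bigr => t _; rewrite /mutInf /E /condEnt -/vA.
    by rewrite mulrAC; congr (_ * _ / _); ring.
  under [X in _ + X / _]eq_bigr do rewrite mulrBr.
  rewrite sumrB -mulr_suml -/KE -/vA natr_sum natr_mul_pred natrM m1E.
  by field; rewrite gt_eqF.
rewrite sumS -[leRHS]/(\sum_i h i).
have -> : \sum_(t < n) (#|S t| * (#|S t| - 1))%:R / 2 * condEnt (rhoAB rho t) (rhoB rho t) = KE / 2.
  by rewrite mulr_suml; apply: eq_bigr => t _; rewrite mulrAC.
(* The case 0 is [ineq1]. In the case delta, S(M|B) = H(M) - I(M:B) removes the Holevo terms, the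
   multiples of [KE] cancel, and [ineq2] remains. *)
rewrite m1E -mulrDr -lerBrDl ge_max; apply/andP; split.
  by rewrite subr_ge0 ler_pdivrMl.
have -> : \sum_i h i = \sum_i sh i - \sum_i ho i.
  by rewrite -sumrB; apply: eq_bigr => i _; exact: hE.
rewrite lerBrDl deltaE [leLHS]addrA lerB //.
rewrite -(ler_pM2l m1); apply: le_trans ineq2; rewrite le_eqVlt; apply/orP; left; apply/eqP.
by field; rewrite gt_eqF.
Qed.
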